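(* Let $(T_1,T_2)$ be a pair of commuting pure contractions on a Hilbert space $\mathcal{H}$ such that $\dim\mathcal{D}_{T_i^*}<\infty$ for $i=1,2$. Then $(T_1,T_2)$ dilates to a pair of commuting pure isometries $(M_\Phi,M_\Psi)$ on $H^2(\mathcal{D}_{T_1^*}\oplus\mathcal{D}_{T_2^*})$, where $(M_\Phi,M_\Psi)$ is the pair of isometries associated to some BCL triple $(\mathcal{D}_{T_1^*}\oplus\mathcal{D}_{T_2^*},U,P)$.
   Context: All Hilbert spaces are complex. A contraction $T$ on $\mathcal{H}$ is pure if $\|T^{*m}h\|\to0$ as $m\to\infty$ for every $h\in\mathcal{H}$; a pair of commuting pure contractions (isometries) is a commuting pair in which each operator is a pure contraction (isometry). For a contraction $T$, $D_{T^*}:=(I-TT^* )^{1/2}$ and $\mathcal{D}_{T^*}:=\overline{D_{T^*}\mathcal{H}}$. A pair $(V_1,V_2)$ of operators on $\mathcal{K}$ is a dilation of $(T_1,T_2)$ on $\mathcal{H}$ (and $(T_1,T_2)$ dilates to $(V_1,V_2)$) if there is an isometry $\Pi:\mathcal{H}\to\mathcal{K}$ with $\Pi T_i^*=V_i^*\Pi$ for $i=1,2$. For a Hilbert space $\mathcal{E}$, $H^2(\mathcal{E})$ is the Hardy space of $\mathcal{E}$-valued analytic functions $\sum_{k\ge0}\eta_kz^k$ on the unit disc $\mathbb{D}$ with $\sum_k\|\eta_k\|^2<\infty$, and $M_\Theta$ denotes multiplication by $\Theta$. A BCL triple $(\mathcal{E},U,P)$ consists of a Hilbert space $\mathcal{E}$,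 a unitary $U$ on $\mathcal{E}$ and an orthogonal projection $P$ on $\mathcal{E}$ (with $P^\perp=I-P$); the associated pair of isometries $(M_\Phi,M_\Psi)$ on $H^2(\mathcal{E})$ has symbols $\Phi(z)=(P+zP^\perp)U^*$ and $\Psi(z)=U(P^\perp+zP)$, $z\in\mathbb{D}$. *)

(* Defs.v *)
From HB Require Import structures.
From mathcomp Require Import all_boot all_order all_algebra.
From mathcomp Require Import sesquilinear complex.
From mathcomp Require Import all_classical all_reals.
From mathcomp Require Import ereal topology normedtype sequences.

Set Implicit Arguments.
Unset Strict Implicit.
Unset Printing Implicit Defensive.

Import Order.TTheory GRing.Theory Num.Theory numFieldNormedType.Exports.

Local Open Scope ring_scope.
Local Open Scope complex_scope.
Local Open Scope classical_set_scope.

(* The topology and norm of the complex field, as a module over itself. *)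
HB.instance Definition _ (R : realType) := NormedModule.copy R[i] R[i]^o.

(* Complex Hilbert spaces; the inner product is linear in its first argument. *)
HB.mixin Record CompleteNormedModule_isHilbert (R : realType) H
    & CompleteNormedModule R[i] H := {
  inner : {dot H for (@Num.conj R[i])} ;
  innerxx : forall x : H, inner x x = `|x| ^+ 2
}.

#[short(type="hilbertType")]
HB.structure Definition Hilbert (R : realType) :=
  {H of CompleteNormedModule R[i] H & CompleteNormedModule_isHilbert R H}.

Section DotNorm.
Variables (C : numClosedFieldType) (V : lmodType C) (form : {dot V for (@Num.conj C)}).
Local Notation "''[' u , v ]" := (form u v).

Lemma dot_CauchySchwarz u v : `|'[u, v]| ^+ 2 <= '[u, u] * '[v, v].
Proof.
have [->|nz_v] := eqVneq v 0.
  by rewrite !linear0r normr0 expr0n mulr0.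
pose a := '[u, v] / '[v, v]; pose w := u - a *: v.
have vv0 : '[v, v] != 0 by rewrite dnorm_eq0.
have ow : '[w, v] = 0.
  by rewrite linearBl /= linearZl_LR /= divfK // subrr.
have -> : u = w + a *: v by rewrite subrK.
rewrite linearDl /= ow add0r linearZl_LR /= normrM (ger0_norm (dnorm_ge0 _ _)).
rewrite exprMn hnormDd /=; last by rewrite linearZr_LR /= ow mulr0.
rewrite dnormZ mulrDl -[X in _ <= _ + X]mulrA -[X in _ <= _ + _ * X]expr2.
by rewrite lerDr mulr_ge0.
Qed.

Lemma dot_triangle u v :
  sqrtC '[u + v, u + v] <= sqrtC '[u, u] + sqrtC '[v, v].
Proof.
rewrite -ler_sqr ?nnegrE ?addr_ge0 ?sqrtC_ge0//.
rewrite sqrrD !sqrtCK addrAC dnormD lerD2l -mulr_natl.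
have re : '[u, v] + ('[u, v])^* = 2 * 'Re '[u, v].
  by rewrite ReE mulrC divfK // pnatr_eq0.
rewrite /= re ler_pM2l ?ltr0n// -sqrtCM ?nnegrE//.
apply: (le_trans (leif_Re_Creal _)).
by rewrite -(sqrCK (normr_ge0 _)) ler_sqrtC ?qualifE/= ?mulr_ge0 ?exprn_ge0 //  dot_CauchySchwarz.
Qed.

Lemma dot_sqrtZ (a : C) u : sqrtC '[a *: u, a *: u] = `|a| * sqrtC '[u, u].
Proof. by rewrite dnormZ sqrtCM ?nnegrE ?exprn_ge0// sqrCK. Qed.

Lemma dot_sqrt_eq0 u : sqrtC '[u, u] = 0 -> u = 0.
Proof. by move/eqP; rewrite sqrt_dnorm_eq0 => /eqP. Qed.
End DotNorm.

Lemma complex_archi (R : realType) (e : R[i]) : 0 < e ->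
  exists N, forall n, (N <= n)%N -> n.+1%:R^-1 < e.
Proof.
case: e => a b; rewrite ltcE /= => /andP[/eqP -> a0].
exists (Num.truncn a^-1) => n Nn.
rewrite invf_plt ?posrE ?ltr0n //; last by rewrite ltcE /= eqxx.
apply: (@lt_le_trans _ _ ((Num.truncn a^-1).+1%:R)); last by rewrite ler_nat.
have -> : (a +i* 0)^-1 = (a^-1)%:C by rewrite fmorphV.
rewrite -(rmorph_nat (real_complex R)) ltcR.
exact: truncnS_gt.
Qed.

HB.factory Record isInnerProduct (C : numClosedFieldType) (V : lmodType C)
    (f : V -> V -> C) := {
  innerPl : forall (a : C) x y z, f (a *: x + y) z = a * f x z + f y z ;
  innerC : forall x y, f x y = Num.conj (f y x) ;
  inner_gt0 : forall x, x != 0 -> 0 < f x x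
}.

HB.builders Context C V f & isInnerProduct C V f.

Lemma inner_bilinear : bilinear_for ( *%R : C -> C -> C) (Num.conj \; *%R) f.
Proof.
split=> [z a x y|z a x y]; first exact: innerPl.
by rewrite innerC innerPl rmorphD rmorphM /= -!innerC.
Qed.

Lemma inner_hermitian x y : f x y = (-1) ^+ false * Num.conj (f y x).
Proof. by rewrite mul1r; exact: innerC. Qed.

HB.instance Definition _ := bilinear_isBilinear.Build C V V C
  *%R (Num.conj \; *%R) f inner_bilinear.
HB.instance Definition _ := isHermitianSesquilinear.Build C V
  false Num.conj f inner_hermitian.
HB.instance Definition _ := isDotProduct.Build C V f inner_gt0.
HB.end.

HB.factory Record Lmodule_isHilbert (R : realType) H & GRing.Lmodule R[i] H := {
  dotp : {dot H for (@Num.conj R[i])} ;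
  dot_complete : forall u : nat -> H,
    (forall e : R[i], 0 < e -> exists N, forall m n, (N <= m)%N -> (N <= n)%N ->
       dotp (u m - u n) (u m - u n) < e) ->
    exists l, forall e : R[i], 0 < e -> exists N, forall n, (N <= n)%N ->
       dotp (u n - l) (u n - l) < e
}.

HB.builders Context R H & Lmodule_isHilbert R H.

HB.instance Definition _ := @Lmodule_isNormed.Build R[i] H
  (fun x => sqrtC (dotp x x)) (dot_triangle dotp) (dot_sqrtZ dotp)
  (@dot_sqrt_eq0 _ _ dotp).

Lemma dotpE x : dotp x x = `|x| ^+ 2.
Proof. by rewrite sqrtCK. Qed.

Lemma dot_cauchy_cvg (F : set_system H) : ProperFilter F -> cauchy F -> cvg F.
Proof.
move=> FF /cauchyP Fc.
have /choice[u Fu] : forall n : nat, exists x, F (ball x n.+1%:R^-1).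
  by move=> n; apply: Fc; rewrite invr_gt0 ltr0n.
have uc m n : `|u m - u n| < m.+1%:R^-1 + n.+1%:R^-1.
  have [y []] := filter_ex (filterI (Fu m) (Fu n)).
  rewrite -!ball_normE /= => um un.
  by rewrite -(subrKA y) (le_lt_trans (ler_normD _ _)) // ltrD // distrC.
have [|l ul] := @dot_complete u.
  move=> e e0.
  have [|N hN] := @complex_archi R (sqrtC e / 2).
    by rewrite divr_gt0 ?sqrtC_gt0.
  exists N => m n Nm Nn; rewrite dotpE -[e]sqrtCK.
  rewrite ltr_pXn2r ?nnegrE ?sqrtC_ge0 ?(ltW e0)//.
  by rewrite (lt_trans (uc m n))// [ltRHS]splitr ltrD// hN.
apply/cvg_ex; exists l; apply/cvgrPdist_lt => e e0.
have e20 : 0 <= e / 2 by rewrite ltW ?divr_gt0.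
have [|N hN] := @complex_archi R (e / 2); first by rewrite divr_gt0.
have [|M hM] := ul ((e / 2) ^+ 2); first by rewrite exprn_gt0 ?divr_gt0.
pose n := maxn N M.
apply: filterS (Fu n) => y; rewrite -ball_normE /= => uy.
rewrite -(subrKA (u n)) (le_lt_trans (ler_normD _ _)) // [ltRHS]splitr ltrD//.
  move: (hM n (leq_maxr _ _)); rewrite dotpE distrC.
  by rewrite ltr_pXn2r ?nnegrE.
exact: (lt_trans uy (hN _ (leq_maxl _ _))).
Qed.

HB.instance Definition _ := @Uniform_isComplete.Build H dot_cauchy_cvg.
HB.instance Definition _ := @CompleteNormedModule_isHilbert.Build R H dotp dotpE.
HB.end.

Lemma hilbert_complete (R : realType) (H : hilbertType R) (u : nat -> H) :
  (forall e : R[i], 0 < e -> exists N, forall m n, (N <= m)%N -> (N <= n)%N ->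
     inner (u m - u n) (u m - u n) < e) ->
  exists2 l, u @ \oo --> l & forall e : R[i], 0 < e ->
    exists N, forall n, (N <= n)%N -> inner (u n - l) (u n - l) < e.
Proof.
move=> uC; have /cvg_ex[l ul] : cvg (u @ \oo).
  apply: cauchy_cvg; apply/cauchyP => e e0.
  have [|N hN] := uC (e ^+ 2); first by rewrite exprn_gt0.
  exists (u N); exists N => // n /= Nn; rewrite -ball_normE /=.
  move: (hN N n (leqnn _) Nn); rewrite innerxx.
  by rewrite ltr_pXn2r ?nnegrE ?(ltW e0).
exists l => // e e0.
have /cvgrPdist_lt /(_ (sqrtC e)) := ul; rewrite sqrtC_gt0 => /(_ e0)[N _ hN].
exists N => n /hN /=; rewrite innerxx distrC -{2}[e]sqrtCK => h.
by rewrite ltr_pXn2r ?nnegrE ?sqrtC_ge0 ?(ltW e0).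
Qed.

Section ClosedSubspace.
Variables (R : realType) (H : hilbertType R).

Record closedSubspace := ClosedSubspace {
  closedSubspace_set :> set H ;
  closedSubspace_submod : submod_closed [in closedSubspace_set] ;
  closedSubspace_closed : closed closedSubspace_set
}.

Variable M : closedSubspace.

Definition in_closedSubspace : {pred H} := [in closedSubspace_set M].
HB.instance Definition _ := GRing.isSubmodClosed.Build R[i] H
  in_closedSubspace (closedSubspace_submod M).

Definition subspace_of := {x : H | x \in in_closedSubspace}.

HB.instance Definition _ := SubChoice.on subspace_of.
HB.instance Definition _ := [SubChoice_isSubLmodule of subspace_of by <:].

Definition subspace_inner (x y : subspace_of) : R[i] := inner (val x) (val y).

Lemma subspace_innerPl a x y z :
  subspace_inner (a *: x + y) z = a * subspace_inner x z + subspace_inner y z.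
Proof. by rewrite /subspace_inner linearP linearDl linearZl_LR. Qed.

Lemma subspace_innerC x y : subspace_inner x y = Num.conj (subspace_inner y x).
Proof. by rewrite /subspace_inner hermC mul1r. Qed.

Lemma subspace_inner_gt0 x : x != 0 -> 0 < subspace_inner x x.
Proof. by rewrite dnorm_gt0. Qed.

HB.instance Definition _ := isInnerProduct.Build R[i] subspace_of subspace_inner
  subspace_innerPl subspace_innerC subspace_inner_gt0.

Lemma subspace_complete (u : nat -> subspace_of) :
    (forall e : R[i], 0 < e -> exists N, forall m n, (N <= m)%N -> (N <= n)%N ->
       subspace_inner (u m - u n) (u m - u n) < e) ->
    exists l, forall e : R[i], 0 < e -> exists N, forall n, (N <= n)%N ->
       subspace_inner (u n - l) (u n - l) < e.
Proof.
move=> uC; have [l ul hl] := hilbert_complete (u := val \o u) uC.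
have Ml : l \in in_closedSubspace.
  apply/mem_set; apply: (closed_cvg (closedSubspace_set M) _ _ _ ul); first exact: closedSubspace_closed.
  by apply: nearW => n; apply/set_mem; exact: (valP (u n)).
by exists (Sub l Ml).
Qed.

HB.instance Definition _ := Lmodule_isHilbert.Build R subspace_of subspace_complete.

End ClosedSubspace.

Section Range.
Variables (R : realType) (H K : hilbertType R) (T : {linear H -> K}).
Lemma closure_range_submod : submod_closed [in closure (range T)].
Proof.
split=> [|a x y].
  by apply/mem_set/subset_closure; exists 0 => //; rewrite linear0.
move=> /set_mem cx /set_mem cy; apply/mem_set.
move=> B; rewrite -nbhs_ballE => -[e /= e0 eB].
have e20 : 0 < e / 2 by rewrite divr_gt0.
have a0 : 0 < `|a| + 1 by rewrite ltr_wpDl.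
have [_ [[h _ <-]]] := cx _ (nbhsx_ballx x _ (divr_gt0 e20 a0)).
have [_ [[k _ <-]]] := cy _ (nbhsx_ballx y _ e20).
rewrite -!ball_normE /= => yk xh; exists (T (a *: h + k)); split; first by exists (a *: h + k).
apply: eB; rewrite -ball_normE /= linearP opprD addrACA -scalerBr.
rewrite (le_lt_trans (ler_normD _ _))// [ltRHS]splitr ler_ltD// normrZ.
move: xh; rewrite ltr_pdivlMr// => /ltW; apply: le_trans.
by rewrite mulrC ler_wpM2l// lerDl.
Qed.
Definition closed_range : closedSubspace K :=
  ClosedSubspace closure_range_submod (@closed_closure _ _).

End Range.
Section Sum.
Variables (R : realType) (E F : hilbertType R).
(* An alias of the product: [E * F] already carries the supremum norm. *)
Definition hsum : Type := (E * F)%type.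
HB.instance Definition _ := GRing.Lmodule.copy hsum (E * F)%type.
Definition hsum_inner (x y : hsum) : R[i] := inner x.1 y.1 + inner x.2 y.2.

Lemma hsum_innerPl a x y z :
  hsum_inner (a *: x + y) z = a * hsum_inner x z + hsum_inner y z.
Proof.
rewrite /hsum_inner /= !linearDl !linearZl_LR /= mulrDr -!addrA; congr (_ + _).
by rewrite addrCA.
Qed.

Lemma hsum_innerC x y : hsum_inner x y = Num.conj (hsum_inner y x).
Proof. by rewrite /hsum_inner rmorphD /= hermC mul1r [X in _ + X]hermC mul1r. Qed.

Lemma hsum_inner_gt0 x : x != 0 -> 0 < hsum_inner x x.
Proof.
case: x => x y; rewrite /hsum_inner /= => xy.
rewrite lt_def addr_ge0 // andbT; apply: contra xy.
by rewrite paddr_eq0 // !dnorm_eq0 => /andP[/eqP-> /eqP->].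
Qed.

HB.instance Definition _ := isInnerProduct.Build R[i] hsum hsum_inner
  hsum_innerPl hsum_innerC hsum_inner_gt0.

Lemma hsum_complete (u : nat -> hsum) :
    (forall e : R[i], 0 < e -> exists N, forall m n, (N <= m)%N -> (N <= n)%N ->
       hsum_inner (u m - u n) (u m - u n) < e) ->
    exists l, forall e : R[i], 0 < e -> exists N, forall n, (N <= n)%N ->
       hsum_inner (u n - l) (u n - l) < e.
Proof.
move=> uC.
have [e e0|l1 _ h1] := hilbert_complete (u := fun n => (u n).1).
  have [N hN] := uC e e0; exists N => m n Nm Nn.
  by apply: le_lt_trans (hN m n Nm Nn); rewrite /hsum_inner lerDl.
have [e e0|l2 _ h2] := hilbert_complete (u := fun n => (u n).2).
  have [N hN] := uC e e0; exists N => m n Nm Nn.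
  by apply: le_lt_trans (hN m n Nm Nn); rewrite /hsum_inner lerDr.
exists (l1, l2) => e e0; have e20 : 0 < e / 2 by rewrite divr_gt0.
have [N1 hN1] := h1 _ e20; have [N2 hN2] := h2 _ e20.
exists (maxn N1 N2) => n; rewrite geq_max => /andP[n1 n2].
by rewrite /hsum_inner /= [ltRHS]splitr ltrD ?hN1 ?hN2.
Qed.

HB.instance Definition _ := Lmodule_isHilbert.Build R hsum hsum_complete.
End Sum.

Section ComplexLimits.
Variable R : realType.
Implicit Types z : R[i].

Lemma complexRe_ge0 z : 0 <= z -> (complex.Re z)%:C = z.
Proof. by case: z => x y; rewrite lecE /= => /andP[/eqP -> _]. Qed.

Lemma cvg_complexR (u : nat -> R) (a : R) :
  u @ \oo --> a -> (fun n => (u n)%:C) @ \oo --> a%:C.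
Proof.
move=> /cvgrPdist_lt ua; apply/cvgrPdist_lt => -[e f].
rewrite ltcE /= => /andP[/eqP -> e0].
have [N _ hN] := ua e e0; exists N => // n /hN /=.
by rewrite -rmorphB /= normc_def /= expr0n addr0 sqrtr_sqr ltcR.
Qed.

Lemma cvg_conj (u : nat -> R[i]) z :
  u @ \oo --> z -> (fun n => Num.conj (u n)) @ \oo --> Num.conj z.
Proof.
move=> /cvgrPdist_lt ua; apply/cvgrPdist_lt => e e0.
have [N _ hN] := ua e e0; exists N => // n /hN /=.
by rewrite -rmorphB /= norm_conjC.
Qed.

Lemma cvg_complex (u : nat -> R[i]) :
  cvgn (fun n => complex.Re (u n)) -> cvgn (fun n => complex.Im (u n)) -> cvgn u.
Proof.
move=> /cvg_ex[a /= ua] /cvg_ex[b /= ub]; apply/cvg_ex.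
exists (a%:C + 'i * b%:C).
rewrite (_ : u = fun n => (complex.Re (u n))%:C + 'i * (complex.Im (u n))%:C).
  apply: cvgD; first exact: cvg_complexR.
  by apply: cvgMr; exact: cvg_complexR.
by apply/funext => n; rewrite -complexE.
Qed.

Lemma complex_normed_cvg (u : nat -> R[i]) (w : nat -> R) :
  (forall n, `|u n| <= (w n)%:C) -> cvgn (series w) -> cvgn (series u).
Proof.
move=> uw cw.
have w0 n : 0 <= w n by rewrite -ler0c (le_trans _ (uw n)).
have dom (f : nat -> R) : (forall n, `|f n| <= w n) -> cvgn (series f).
  move=> fw; apply: normed_cvg; apply: (series_le_cvg _ w0 fw cw) => n.
  exact: normr_ge0.
have reim n : `|complex.Re (u n)| <= w n /\ `|complex.Im (u n)| <= w n.
  move: (uw n); case: (u n) => x y; rewrite normc_def lecR /= => h.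
  by split; apply: le_trans h; rewrite -sqrtr_sqr ler_wsqrtr // ?lerDl ?lerDr sqr_ge0.
have [cR cI] : cvgn (series (@complex.Re R \o u)) /\ cvgn (series (@complex.Im R \o u)).
  by split; apply: dom => n; case: (reim n).
have sR : series (@complex.Re R \o u) = (fun n => complex.Re (series u n)).
  by apply/funext => n; rewrite /series /= (raddf_sum (@complex.Re R : Rcomplex R -> R)).
have sI : series (@complex.Im R \o u) = (fun n => complex.Im (series u n)).
  by apply/funext => n; rewrite /series /= (raddf_sum (@complex.Im R : Rcomplex R -> R)).
by apply: cvg_complex; rewrite -?sR -?sI.
Qed.
End ComplexLimits.

(* [`|x|] lives in [R[i]]; [hnorm x] is the same number in [R]. *)
Definition hnorm (R : realType) (H : hilbertType R) (x : H) : R := @complex.Re R `|x|.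

Section HNorm.
Variables (R : realType) (H : hilbertType R).
Implicit Types x y : H.

Lemma hnormE x : (hnorm x)%:C = `|x|.
Proof. exact: complexRe_ge0. Qed.

Lemma hnorm_ge0 x : 0 <= hnorm x.
Proof. by rewrite -ler0c hnormE. Qed.

Lemma hnorm_sqr x : (hnorm x ^+ 2)%:C = inner x x.
Proof. by rewrite rmorphXn /= hnormE innerxx. Qed.

Lemma hnorm0 : hnorm (0 : H) = 0.
Proof. by apply: (@complexI R); rewrite hnormE normr0. Qed.

Lemma hnormZ (a : R[i]) x : hnorm (a *: x) = @complex.Re R `|a| * hnorm x.
Proof.
apply: (@complexI R); rewrite rmorphM /= !hnormE normrZ.
by congr (_ * _); rewrite complexRe_ge0.
Qed.

Lemma hnormD x y : hnorm (x + y) <= hnorm x + hnorm y.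
Proof. by rewrite -lecR rmorphD /= !hnormE ler_normD. Qed.

Lemma hnormD_sqr x y : hnorm (x + y) ^+ 2 <= (hnorm x ^+ 2 + hnorm y ^+ 2) *+ 2.
Proof.
apply: (@le_trans _ _ ((hnorm x + hnorm y) ^+ 2)).
  by rewrite ler_pXn2r ?nnegrE ?addr_ge0 ?hnorm_ge0 ?hnormD.
by rewrite sqrrD mulr2n addrAC lerD2l leif_mean_square_scaled.
Qed.

Lemma norm_inner_le x y : `|inner x y| <= (hnorm x ^+ 2 + hnorm y ^+ 2)%:C.
Proof.
have : `|inner x y| <= (hnorm x * hnorm y)%:C.
  rewrite -(@ler_pXn2r _ 2) ?nnegrE ?normr_ge0 // ?ler0c ?mulr_ge0 ?hnorm_ge0//.
  rewrite (le_trans (dot_CauchySchwarz _ _ _)) //.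
  by rewrite -rmorphXn /= exprMn rmorphM /= !hnorm_sqr.
move=> /le_trans; apply; rewrite lecR.
apply: le_trans (leif_mean_square_scaled _ _).
by rewrite mulr2n lerDl mulr_ge0 ?hnorm_ge0.
Qed.

Lemma hnorm_lt x (e : R) : 0 < e -> (hnorm x ^+ 2 < e ^+ 2) = (hnorm x < e).
Proof. by move=> e0; rewrite ltr_pXn2r ?nnegrE ?hnorm_ge0 ?(ltW e0). Qed.

Lemma cvg_hnorm (u : nat -> H) l : u @ \oo --> l -> (fun n => hnorm (u n)) @ \oo --> hnorm l.
Proof.
move=> /cvgrPdist_lt ul; apply/cvgrPdist_lt => e e0.
have [|N _ hN] := ul e%:C; first by rewrite ltcR.
exists N => // n /hN /=; rewrite -hnormE ltcR; apply: le_lt_trans.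
rewrite -lecR hnormE (le_trans _ (ler_dist_dist _ _)) //.
by rewrite -!hnormE -rmorphB normc_def /= expr0n addr0 sqrtr_sqr.
Qed.

End HNorm.

Section H2.
Variables (R : realType) (E : hilbertType R).

Definition square_summable : set (nat -> E) :=
  [set f | cvgn (series (fun k => hnorm (f k) ^+ 2))].

Lemma square_summable_submod : submod_closed [in square_summable].
Proof.
split=> [|a f g /set_mem sf /set_mem sg].
  apply/mem_set; rewrite /square_summable /=.
  rewrite (_ : series _ = fun=> 0); first exact: is_cvg_cst.
  apply/funext => n; rewrite /series /= big1 // => k _.
  by rewrite -[X in hnorm X]/(0 : E) hnorm0 expr0n.
apply/mem_set; pose A := @complex.Re R `|a|.
pose v k := (A ^+ 2 * hnorm (f k) ^+ 2 + hnorm (g k) ^+ 2) *+ 2.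
have v0 k : 0 <= v k.
  apply: mulrn_wge0; apply: addr_ge0; last exact: sqr_ge0.
  by apply: mulr_ge0; exact: sqr_ge0.
apply: (series_le_cvg _ v0) => [k|k|]; first exact: sqr_ge0.
  by rewrite /v -exprMn -hnormZ hnormD_sqr.
pose f2 k := hnorm (f k) ^+ 2; pose g2 k := hnorm (g k) ^+ 2.
rewrite (_ : v = (A ^+ 2 *+ 2 *: f2 + 2 *: g2)).
  apply: is_cvg_seriesD; exact: is_cvg_seriesZ.
by apply/funext => k; rewrite /v !mulr2n -[RHS]/(_ * _ + _ * _) !mulrDl !mul1r addrACA.
Qed.

Definition in_H2 : {pred nat -> E} := [in square_summable].
HB.instance Definition _ := GRing.isSubmodClosed.Build R[i] (nat -> E)
  in_H2 square_summable_submod.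

(* An element of H2 is stored as the sequence of its Taylor coefficients;
   [H2_eval] below recovers the analytic function on the disc. *)
Definition H2 := {f : nat -> E | f \in in_H2}.
HB.instance Definition _ := SubChoice.on H2.
HB.instance Definition _ := [SubChoice_isSubLmodule of H2 by <:].

Implicit Types f g h : H2.

Definition H2_inner f g : R[i] := limn (series (fun k => inner (val f k) (val g k))).

Lemma H2_summable f : cvgn (series (fun k => hnorm (val f k) ^+ 2)).
Proof. exact: (set_mem (valP f)). Qed.

Lemma H2_inner_cvg f g : cvgn (series (fun k => inner (val f k) (val g k))).
Proof.
apply: (complex_normed_cvg (fun n => norm_inner_le _ _)).
apply: is_cvg_seriesD; exact: H2_summable.
Qed.

Lemma H2_innerPl a f g h :
  H2_inner (a *: f + g) h = a * H2_inner f h + H2_inner g h.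
Proof.
rewrite /H2_inner -[a * _]/(a *: _) -lim_seriesZ; last exact: H2_inner_cvg.
rewrite -lim_seriesD; [|by apply: is_cvg_seriesZ; exact: H2_inner_cvg|exact: H2_inner_cvg].
congr (limn (series _)); apply/funext => k /=.
by rewrite linearDl linearZl_LR.
Qed.

Lemma H2_innerC f g : H2_inner f g = Num.conj (H2_inner g f).
Proof.
apply: cvg_lim => //.
rewrite (_ : series _ = fun n => Num.conj (series (fun k => inner (val g k) (val f k)) n)).
  apply: cvg_conj; exact: H2_inner_cvg.
apply/funext => n; rewrite /series /= rmorph_sum; apply: eq_bigr => k _.
by rewrite hermC mul1r.
Qed.

Definition H2_sqr f : R := limn (series (fun k => hnorm (val f k) ^+ 2)).

Lemma H2_innerxx f : H2_inner f f = (H2_sqr f)%:C.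
Proof.
apply: cvg_lim => //.
rewrite (_ : series _ = fun n => (series (fun k => hnorm (val f k) ^+ 2) n)%:C).
  apply: cvg_complexR; exact: H2_summable.
apply/funext => n; rewrite /series /= rmorph_sum; apply: eq_bigr => k _.
exact/esym/hnorm_sqr.
Qed.

Lemma H2_partial_le f n : \sum_(0 <= k < n) hnorm (val f k) ^+ 2 <= H2_sqr f.
Proof.
apply: (nondecreasing_cvgn_le _ (@H2_summable f)).
by apply: nondecreasing_series => k _ _; exact: sqr_ge0.
Qed.

Lemma H2_coord_le f n : hnorm (val f n) ^+ 2 <= H2_sqr f.
Proof.
apply: le_trans (H2_partial_le f n.+1); rewrite big_nat_recr //= lerDr.
by apply: sumr_ge0 => k _; exact: sqr_ge0.
Qed.

Lemma H2_inner_gt0 f : f != 0 -> 0 < H2_inner f f.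
Proof.
move=> f0; rewrite H2_innerxx -[0]/(0%:C) ltcR.
have [k fk] : exists k, val f k != 0.
  apply: contrapT => /forallNP fk; move/eqP: f0; apply; apply/val_inj/funext => k.
  by apply/eqP/negP => /negP; exact: fk.
apply: lt_le_trans (H2_coord_le f k); rewrite exprn_gt0 //.
rewrite -ltcR hnormE normr_gt0 //.
Qed.

HB.instance Definition _ := isInnerProduct.Build R[i] H2 H2_inner
  H2_innerPl H2_innerC H2_inner_gt0.

Lemma H2_complete (u : nat -> H2) :
    (forall e : R[i], 0 < e -> exists N, forall m n, (N <= m)%N -> (N <= n)%N ->
       H2_inner (u m - u n) (u m - u n) < e) ->
    exists l, forall e : R[i], 0 < e -> exists N, forall n, (N <= n)%N ->
       H2_inner (u n - l) (u n - l) < e.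
Proof.
move=> uC.
have /choice[g ug] : forall k : nat, exists l : E, (fun n => val (u n) k) @ \oo --> l.
  move=> k; have [e e0|l ul _] := hilbert_complete (u := fun n => val (u n) k).
    have [N hN] := uC e e0; exists N => m n Nm Nn.
    apply: le_lt_trans (hN m n Nm Nn).
    by rewrite -hnorm_sqr H2_innerxx lecR; exact: (H2_coord_le (u m - u n)).
  by exists l.
have bnd (e : R) : 0 < e -> exists N, forall n, (N <= n)%N -> forall K,
    \sum_(0 <= k < K) hnorm (val (u n) k - g k) ^+ 2 <= e.
  move=> e0; have [|N hN] := uC e%:C; first by rewrite ltcR.
  exists N => n Nn K.
  have cK : (fun m => \sum_(0 <= k < K) hnorm (val (u n) k - val (u m) k) ^+ 2) @ \oo
      --> \sum_(0 <= k < K) hnorm (val (u n) k - g k) ^+ 2.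
    apply: cvg_big => [|k _].
      exact: add_continuous.
    by apply: cvgM; apply: cvg_hnorm; apply: cvgB (ug k); exact: cvg_cst.
  rewrite -(cvg_lim _ cK) //; apply: limr_le; first by apply/cvg_ex; eexists; exact: cK.
  exists N => // m /= Nm; apply: (le_trans (H2_partial_le (u n - u m) K)).
  by have := hN n m Nn Nm; rewrite H2_innerxx ltcR => /ltW.
have gs : g \in in_H2.
  have [N hN] := bnd 1 ltr01.
  have sd : val (u N) - g \in in_H2.
    apply/mem_set; apply: nondecreasing_is_cvgn.
      by apply: nondecreasing_series => k _ _; exact: sqr_ge0.
    by exists 1 => _ [K _ <-]; exact: hN.
  by rewrite -(subKr (val (u N)) g) rpredB //; exact: valP.
exists (Sub g gs) => -[e e']; rewrite ltcE /= => /andP[/eqP -> e0].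
have [|N hN] := bnd (e / 2); first by rewrite divr_gt0.
exists N => n Nn; rewrite H2_innerxx ltcR.
apply: (@le_lt_trans _ _ (e / 2)); last by rewrite ltr_pdivrMr // ltr_pMr // ltr1n.
apply: limr_le; first exact: H2_summable.
by apply: nearW => K; exact: hN.
Qed.

HB.instance Definition _ := Lmodule_isHilbert.Build R H2 H2_complete.
End H2.

Definition H2_eval (R : realType) (E : hilbertType R) (f : H2 E) (z : R[i]) : E :=
  limn (series (fun k => z ^+ k *: val f k)).

Section Operators.
Variable R : realType.
Implicit Types H K : hilbertType R.

Definition bounded_op H K (T : H -> K) : Prop := linear T /\ continuous T.

(* For bounded [T] the element [x] exists (Riesz) and is unique. *)
Definition adj H K (T : H -> K) : K -> H :=
  fun y => xget 0 [set x | forall h, inner (T h) y = inner h x].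

Definition positive_op H (S : H -> H) : Prop :=
  bounded_op S /\ forall x, 0 <= inner (S x) x.

(* For positive [A] there is exactly one positive [S] with [S \o S = A]. *)
Definition sqrt_op H (A : H -> H) : H -> H :=
  xget (fun=> 0) [set S | positive_op S /\ forall x, S (S x) = A x].

Lemma sqrt_op_linear H (A : H -> H) : linear (sqrt_op A).
Proof.
rewrite /sqrt_op; case: xgetP => [S _ [[[]]]//|_ a x y].
by rewrite scaler0 addr0.
Qed.

HB.instance Definition _ H (A : H -> H) :=
  GRing.isLinear.Build R[i] H H *:%R (sqrt_op A) (sqrt_op_linear A).

Definition contractive H K (T : H -> K) : Prop :=
  linear T /\ forall x, `|T x| <= `|x|.

Definition isometric H K (V : H -> K) : Prop :=
  linear V /\ forall x, `|V x| = `|x|.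

Definition pure H (T : H -> H) : Prop :=
  forall h, (fun m => `|iter m (adj T) h|) @ \oo --> (0 : R[i]).

Definition commuting_pure_contractions H (T1 T2 : H -> H) : Prop :=
  [/\ contractive T1 /\ pure T1, contractive T2 /\ pure T2 &
      forall h, T1 (T2 h) = T2 (T1 h)].

Definition commuting_pure_isometries H (V1 V2 : H -> H) : Prop :=
  [/\ isometric V1 /\ pure V1, isometric V2 /\ pure V2 &
      forall h, V1 (V2 h) = V2 (V1 h)].

(* The argument is [T] itself: this is the defect operator of the adjoint
   of [T], namely the square root of [1 - T \o adj T]. *)
Definition defect_op H (T : H -> H) : H -> H :=
  sqrt_op (fun h => h - T (adj T h)).

HB.instance Definition _ H (T : H -> H) := GRing.Linear.on (defect_op T).

Definition defect_space H (T : H -> H) : hilbertType R :=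
  subspace_of (closed_range (defect_op T)).

Definition finite_dimensional (V : lmodType R[i]) : Prop :=
  exists (n : nat) (e : 'I_n -> V),
    forall x, exists c : 'I_n -> R[i], x = \sum_i c i *: e i.

Definition dilation H K (T1 T2 : H -> H) (V1 V2 : K -> K) : Prop :=
  exists Pi : H -> K, [/\ isometric Pi,
    forall h, Pi (adj T1 h) = adj V1 (Pi h) &
    forall h, Pi (adj T2 h) = adj V2 (Pi h)].

Definition unitary H (U : H -> H) : Prop :=
  [/\ bounded_op U, forall x, adj U (U x) = x & forall x, U (adj U x) = x].

Definition orthogonal_projection H (P : H -> H) : Prop :=
  [/\ bounded_op P, forall x, P (P x) = P x & forall x, adj P x = P x].

Definition BCL_triple (E : hilbertType R) (U P : E -> E) : Prop :=
  unitary U /\ orthogonal_projection P.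

Definition perp (E : hilbertType R) (P : E -> E) : E -> E := fun x => x - P x.

Definition BCL_Phi (E : hilbertType R) (U P : E -> E) (z : R[i]) : E -> E :=
  fun x => P (adj U x) + z *: perp P (adj U x).

Definition BCL_Psi (E : hilbertType R) (U P : E -> E) (z : R[i]) : E -> E :=
  fun x => U (perp P x + z *: P x).

(* The element [g] is unique when it exists, as Taylor coefficients are
   determined by the values on the disc. *)
Definition mult_op (E : hilbertType R) (Theta : R[i] -> E -> E) : H2 E -> H2 E :=
  fun f => xget 0 [set g | forall z : R[i], `|z| < 1 ->
    H2_eval g z = Theta z (H2_eval f z)].

End Operators.

(* Main.v *)
(* Write S_i for the adjoint of T_i and D_i for the defect operator, so that
   |D_i g|^2 = |g|^2 - |S_i g|^2. Expanding 1 - T_1 T_2 S_1 S_2 in two ways gives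
     |D_1 g|^2 + |D_2 S_1 g|^2 = |D_1 S_2 g|^2 + |D_2 g|^2,
   hence an isometry (D_1 g, D_2 S_1 g) |-> (D_1 S_2 g, D_2 g) between subspaces
   of the finite-dimensional space E = D_1 (+) D_2; extend it to a unitary W.
   With U = W^* and P the projection onto the second summand, the map sending h
   to the sequence (D_1 S^k h, D_2 S_1 S^k h), where S = S_1 S_2, is the dilation.
   Any extension W makes both isometries pure: if u_m = (U P)^m x = (a_m, b_m),
   then <b_m, D_2 g> = <b_(m+1), D_2 S_1 g> + <a_(m+1), D_1 g>; iterating, and
   using that S_1 is strongly stable and that the sums of |a_m|^2 and
   |D_1 S_1^m g|^2 telescope, b_m tends to 0, weakly and hence in norm. So the
   adjoint of the isometry is strongly stable on constants, by induction on the
   degree on polynomials, and by density everywhere. *)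
From HB Require Import structures.
From mathcomp Require Import all_boot all_order all_algebra.
From mathcomp Require Import sesquilinear complex ring lra.
From mathcomp Require Import all_classical all_reals.
From mathcomp Require Import topology normedtype sequences.
Require Import Defs.

Set Implicit Arguments.
Unset Strict Implicit.
Unset Printing Implicit Defensive.

Import Order.TTheory GRing.Theory Num.Theory numFieldNormedType.Exports.

Local Open Scope ring_scope.
Local Open Scope complex_scope.
Local Open Scope classical_set_scope.

(** * Inner products and adjoints *)

Lemma conj_real (R : realType) (r : R) : Num.conj (r%:C) = r%:C.
Proof. by apply/eqP; rewrite eq_complex /= oppr0 !eqxx. Qed.

Section InnerProduct.
Variables (R : realType) (H : hilbertType R).
Implicit Types (x y z : H) (a : R[i]).

Lemma innerC x y : inner x y = Num.conj (inner y x).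
Proof. by rewrite hermC mul1r. Qed.
Lemma innerDl x y z : inner (x + y) z = inner x z + inner y z.
Proof. exact: linearDl. Qed.
Lemma innerDr x y z : inner z (x + y) = inner z x + inner z y.
Proof. exact: linearDr. Qed.
Lemma innerBl x y z : inner (x - y) z = inner x z - inner y z.
Proof. exact: linearBl. Qed.
Lemma innerBr x y z : inner z (x - y) = inner z x - inner z y.
Proof. exact: linearBr. Qed.
Lemma innerZl a x y : inner (a *: x) y = a * inner x y.
Proof. exact: linearZl_LR. Qed.
Lemma innerZr a x y : inner x (a *: y) = Num.conj a * inner x y.
Proof. exact: linearZr_LR. Qed.
Lemma inner0l x : inner 0 x = 0. Proof. exact: linear0l. Qed.
Lemma inner0r x : inner x 0 = 0. Proof. exact: linear0r. Qed.

Lemma inner_eq0 x : inner x x = 0 -> x = 0.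
Proof. by move/eqP; rewrite dnorm_eq0 => /eqP. Qed.

Lemma inner_injr x y : (forall z, inner z x = inner z y) -> x = y.
Proof.
by move=> xy; apply/eqP; rewrite -subr_eq0; apply/eqP/inner_eq0; rewrite innerBr xy subrr.
Qed.

Lemma hnorm_eq0 x : hnorm x = 0 -> x = 0.
Proof. by move=> x0; apply: inner_eq0; rewrite -hnorm_sqr x0 expr0n. Qed.

Lemma hnorm_sqrE x : hnorm x ^+ 2 = complex.Re (inner x x).
Proof. by rewrite -hnorm_sqr. Qed.

Lemma norm_innerE x y : (complex.Re `|inner x y|)%:C = `|inner x y|.
Proof. exact: complexRe_ge0. Qed.

Lemma inner_CauchySchwarz x y : `|inner x y| <= (hnorm x * hnorm y)%:C.
Proof.
rewrite -(@ler_pXn2r _ 2) ?nnegrE ?normr_ge0 // ?ler0c ?mulr_ge0 ?hnorm_ge0//.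
rewrite (le_trans (dot_CauchySchwarz _ _ _)) //.
by rewrite -rmorphXn /= exprMn rmorphM /= !hnorm_sqr.
Qed.

Lemma hnorm_oppr x : hnorm (- x) = hnorm x.
Proof. by apply: complexI; rewrite !hnormE normrN. Qed.

Lemma hnorm_distC x y : hnorm (x - y) = hnorm (y - x).
Proof. by rewrite -hnorm_oppr opprB. Qed.

Lemma hnormZr (r : R) x : 0 <= r -> hnorm (r%:C *: x) = r * hnorm x.
Proof. by move=> r0; rewrite hnormZ ger0_norm ?ler0c. Qed.

Lemma hnorm_le_sqr (K : hilbertType R) x (y : K) :
  (hnorm x <= hnorm y) = (hnorm x ^+ 2 <= hnorm y ^+ 2).
Proof. by rewrite ler_pXn2r ?nnegrE ?hnorm_ge0. Qed.

Lemma hnorm_norm (K : hilbertType R) x (y : K) : (`|x| <= `|y|) = (hnorm x <= hnorm y).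
Proof. by rewrite -!hnormE lecR. Qed.

(** A positive element of [R[i]] has zero imaginary part, so real [e] are enough to test
    convergence. *)
Lemma cvgP_hnorm (u : nat -> H) l :
  (u @ \oo --> l) <-> forall e : R, 0 < e -> exists N, forall n, (N <= n)%N -> hnorm (u n - l) < e.
Proof.
split=> [/cvgrPdist_lt ul e e0|ul].
  have [|N _ hN] := ul e%:C; first by rewrite ltcR.
  by exists N => n /hN /=; rewrite -hnormE ltcR hnorm_distC.
apply/cvgrPdist_lt => -[e f]; rewrite ltcE /= => /andP[/eqP -> e0].
have [N hN] := ul e e0; exists N => // n /= Nn.
by rewrite -hnormE ltcR hnorm_distC hN.
Qed.

Lemma cvg0P_hnorm (u : nat -> H) : (fun n => `|u n|) @ \oo --> (0 : R[i]) <->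
  forall e : R, 0 < e -> exists N, forall n, (N <= n)%N -> hnorm (u n) < e.
Proof.
split=> [/cvgrPdist_lt ul e e0|ul].
  have [|N _ hN] := ul e%:C; first by rewrite ltcR.
  by exists N => n /hN /=; rewrite sub0r normrN normr_id -hnormE ltcR.
apply/cvgrPdist_lt => -[e f]; rewrite ltcE /= => /andP[/eqP -> e0].
have [N hN] := ul e e0; exists N => // n /= Nn.
by rewrite sub0r normrN normr_id -hnormE ltcR hN.
Qed.

Lemma hnorm_complete (u : nat -> H) :
  (forall e : R, 0 < e -> exists N, forall m n, (N <= m)%N -> (N <= n)%N ->
     hnorm (u m - u n) < e) -> exists l : H, u @ \oo --> l.
Proof.
move=> uC; have [|l ul _] := @hilbert_complete R H u; last by exists l.
move=> -[e f]; rewrite ltcE /= => /andP[/eqP -> e0].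
have [|N hN] := uC (Num.sqrt e); first by rewrite sqrtr_gt0.
exists N => m n Nm Nn; rewrite -hnorm_sqr ltcR.
by rewrite -[e]sqr_sqrtr ?(ltW e0)// hnorm_lt ?sqrtr_gt0 // hN.
Qed.

Lemma cvg_innerl (u : nat -> H) l y :
  u @ \oo --> l -> (fun n => inner (u n) y) @ \oo --> inner l y.
Proof.
move=> /cvgP_hnorm ul; apply/cvgrPdist_lt => -[e f]; rewrite ltcE /= => /andP[/eqP -> e0].
have y0 : 0 < hnorm y + 1 by rewrite ltr_wpDl ?hnorm_ge0.
have [|N hN] := ul (e / (hnorm y + 1)); first by rewrite divr_gt0.
exists N => // n /= /hN; rewrite ltr_pdivlMr // => uln.
rewrite -innerBl; apply: le_lt_trans (inner_CauchySchwarz _ _) _.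
rewrite ltcR hnorm_distC; apply: le_lt_trans uln.
by rewrite ler_wpM2l ?hnorm_ge0 // lerDl.
Qed.

Lemma cvg_innerr (u : nat -> H) l y :
  u @ \oo --> l -> (fun n => inner y (u n)) @ \oo --> inner y l.
Proof.
move=> ul; rewrite innerC (_ : (fun n => _) = fun n => Num.conj (inner (u n) y)).
  exact/cvg_conj/cvg_innerl.
by apply/funext => n; rewrite -innerC.
Qed.

End InnerProduct.

(** * Linear maps, contractions and honest adjoints *)

Section LinearMaps.
Variables (R : realType) (H K : hilbertType R).

(** Operators are plain functions with a separate linearity proof; bundling the two gives access to
    the general theory of linear maps. *)
Definition linear_of (T : H -> K) (T_lin : linear T) : {linear H -> K} :=
  HB.pack T (GRing.isLinear.Build R[i] H K *:%R T T_lin).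

Variable T : H -> K.

Lemma lin0 : linear T -> T 0 = 0.
Proof. by move=> Tl; exact: (linear0 (linear_of Tl)). Qed.
Lemma linD : linear T -> forall x y, T (x + y) = T x + T y.
Proof. by move=> Tl; exact: (linearD (linear_of Tl)). Qed.
Lemma linB : linear T -> forall x y, T (x - y) = T x - T y.
Proof. by move=> Tl; exact: (linearB (linear_of Tl)). Qed.
Lemma linZ : linear T -> forall a x, T (a *: x) = a *: T x.
Proof. by move=> Tl; exact: (linearZ_LR (linear_of Tl)). Qed.
Lemma lin_sum : linear T -> forall I (r : seq I) (P : pred I) (F : I -> H),
  T (\sum_(i <- r | P i) F i) = \sum_(i <- r | P i) T (F i).
Proof. by move=> Tl; exact: (linear_sum (linear_of Tl)). Qed.

Lemma contractive_hnorm : contractive T -> forall x, hnorm (T x) <= hnorm x.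
Proof. by case=> _ Tc x; rewrite -hnorm_norm. Qed.

Lemma contractive_continuous : contractive T -> continuous T.
Proof.
move=> Tc x; have [Tl _] := Tc; apply/cvgrPdist_lt => e e0.
near=> y; rewrite -(linB Tl) (le_lt_trans (Tc.2 _)) //.
Unshelve. all: by end_near. Qed.

Lemma isometric_contractive : isometric T -> contractive T.
Proof. by case=> Tl Ti; split=> // x; rewrite Ti. Qed.

Lemma isometric_hnorm : isometric T -> forall x, hnorm (T x) = hnorm x.
Proof. by case=> _ Ti x; rewrite /hnorm Ti. Qed.

(* [T'] is an honest adjoint of [T], as opposed to [adj T], which is only
   meaningful once its existence is known. *)
Definition adjoint (T' : K -> H) := forall x y, inner (T x) y = inner x (T' y).

(** The inner product is nondegenerate, so the vector chosen by [adj] is the only candidate and must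
    be [T' y]. *)
Lemma adjoint_adj (T' : K -> H) : adjoint T' -> adj T = T'.
Proof.
move=> TT'; apply/funext => y; rewrite /adj; apply: xget_unique => [h|z hz].
  exact: TT'.
by apply: inner_injr => h; rewrite -hz TT'.
Qed.

(** Combined with [adjoint_sym], this also yields linearity of any map that is itself known to have
    an adjoint. *)
Lemma adjoint_linear (T' : K -> H) : adjoint T' -> linear T'.
Proof.
move=> TT' a x y; apply: inner_injr => h.
by rewrite -TT' !innerDr !innerZr -!TT'.
Qed.

(** By Cauchy-Schwarz, [|T' y|^2 = <T (T' y), y> <= |T' y| |y|]; divide by [|T' y|] when it is
    nonzero. *)
Lemma adjoint_contractive (T' : K -> H) : contractive T -> adjoint T' -> contractive T'.
Proof.
move=> Tc TT'; split=> [|y]; first exact: adjoint_linear.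
rewrite hnorm_norm; have [->|] := eqVneq (hnorm (T' y)) 0; first exact: hnorm_ge0.
move=> nz; have p : 0 < hnorm (T' y) by rewrite lt_def nz hnorm_ge0.
rewrite -(ler_pM2l p) -expr2.
have : `|inner (T (T' y)) y| <= (hnorm (T' y) * hnorm y)%:C.
  apply: le_trans (inner_CauchySchwarz _ _) _.
  by rewrite lecR ler_wpM2r ?hnorm_ge0 ?contractive_hnorm.
by rewrite TT' -hnorm_sqr ger0_norm ?lecR // sqr_ge0.
Qed.

End LinearMaps.

Lemma adjoint_sym (R : realType) (H K : hilbertType R) (T : H -> K) (T' : K -> H) :
  adjoint T T' -> adjoint T' T.
Proof. by move=> TT' x y; rewrite innerC -TT' -innerC. Qed.

Lemma adjoint_comp (R : realType) (H1 H2 H3 : hilbertType R) (f : H2 -> H3) (f' : H3 -> H2)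
    (g : H1 -> H2) (g' : H2 -> H1) :
  adjoint f f' -> adjoint g g' -> adjoint (f \o g) (g' \o f').
Proof. by move=> ff gg x y /=; rewrite ff gg. Qed.

(** * Existence of adjoints of contractions *)

Lemma norm_le_eps (R : realType) (z : R[i]) (b : R) : 0 <= b ->
  (forall e : R, 0 < e -> `|z| <= (e * b)%:C) -> z = 0.
Proof.
move=> b0 h; apply/eqP; rewrite -normr_eq0 eq_le normr_ge0 andbT.
rewrite -(complexRe_ge0 (normr_ge0 z)) lecR.
apply/ler_addgt0Pl => e e0; rewrite addr0.
have b1 : 0 < b + 1 by rewrite ltr_wpDl.
have := h (e / (b + 1)) (divr_gt0 e0 b1).
rewrite -[leLHS](complexRe_ge0 (normr_ge0 z)) lecR => /le_trans; apply.
by rewrite mulrAC -mulrA ler_piMr ?(ltW e0)// ler_pdivrMr // mul1r lerDl.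
Qed.

Lemma exists_invS_lt (R : realType) (e : R) : 0 < e -> exists N, forall n, (N <= n)%N -> n.+1%:R^-1 < e.
Proof.
move=> e0; have [|N hN] := @complex_archi R e%:C; first by rewrite ltcR.
exists N => n /hN; rewrite -ltcR fmorphV /= rmorphMn //=.
Qed.

Section Riesz.
Variables (R : realType) (H K : hilbertType R) (T : H -> K).
Hypothesis T_contr : contractive T.

(* The Riesz vector is the minimiser of [riesz_fun]; a near-minimiser already
   represents the functional [fun h => inner (T h) y] up to a small error. *)
Let riesz_fun (y : K) (x : H) : R := hnorm x ^+ 2 - complex.Re (inner (T x) y) *+ 2.

(** With [w] the error at [h], moving [x] by [- t conj(w) h] changes [riesz_fun] by
    [- 2 t |w|^2 + t^2 |w|^2 |h|^2]. Near-minimality of [x] bounds the possible decrease by [d]. *)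
Lemma riesz_near_min y x (m d : R) : (forall x', m <= riesz_fun y x') ->
  riesz_fun y x <= m + d ->
  forall h, (`|inner h x - inner (T h) y| <= (Num.sqrt d * hnorm h)%:C).
Proof.
move=> hm hx h; set w := _ - _; have Tl := T_contr.1.
pose N := complex.Re w ^+ 2 + complex.Im w ^+ 2; pose q := hnorm h ^+ 2.
have J (t : R) : riesz_fun y (x - (t%:C * Num.conj w) *: h) =
    riesz_fun y x - t * 2 * N + t ^+ 2 * (N * q).
  rewrite /riesz_fun !hnorm_sqrE (linB Tl) (linZ Tl) /=.
  rewrite !(innerBl, innerBr, innerZl, innerZr) (innerC x h) -(hnorm_sqr x) -(hnorm_sqr h) -/q.
  rewrite /N /w {N w}.
  case: (inner h x) => a b; case: (inner (T h) y) => a' b'; case: (inner (T x) y) => a'' b''.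
  by simpc; rewrite /=; ring.
have w2 : `|w| ^+ 2 = N%:C by rewrite -add_Re2_Im2.
rewrite -(@ler_pXn2r _ 2) ?nnegrE ?normr_ge0 // ?ler0c ?mulr_ge0 ?hnorm_ge0 ?sqrtr_ge0 //.
have [h0|nz] := eqVneq (hnorm h) 0.
  have := hnorm_eq0 h0; rewrite /w => ->.
  by rewrite (lin0 Tl) !inner0l subrr normr0 expr0n exprn_ge0 // ler0c mulr_ge0 ?sqrtr_ge0 ?hnorm_ge0.
have q0 : 0 < q by rewrite /q exprn_gt0 // lt_def nz hnorm_ge0.
(* The choice [t = 1 / |h|^2] minimises the quadratic and leaves [|w|^2 / |h|^2 <= d]. *)
have := hm (x - (q^-1%:C * Num.conj w) *: h); rewrite J.
have -> : q^-1 ^+ 2 * (N * q) = q^-1 * N by field; rewrite gt_eqF.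
move=> h1; have h2 : q^-1 * N <= d by lra.
have d0 : 0 <= d by have := hm x; lra.
by rewrite w2 -rmorphXn lecR /= exprMn sqr_sqrtr // -ler_pdivrMr // mulrC.
Qed.

(** Riesz representation of [h |-> <T h, y>]: a minimising sequence is Cauchy, and its limit
    represents the functional without error. *)
Lemma exists_adjoint : exists T', adjoint T T'.
Proof.
suff /choice[T' hT'] : forall y, exists x, forall h, inner (T h) y = inner h x.
  by exists T' => x y; exact: hT'.
move=> y; pose J := riesz_fun y.
(* Contractivity gives [2 Re <T x, y> <= 2 |x| |y| <= |x|^2 + |y|^2]. *)
have J_lb x : - hnorm y ^+ 2 <= J x.
  have /(le_trans (normc_ge_Re _)) := inner_CauchySchwarz (T x) y.
  rewrite lecR /J /riesz_fun => h.
  have h1 : hnorm (T x) * hnorm y <= hnorm x * hnorm y.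
    by rewrite ler_wpM2r ?hnorm_ge0 ?contractive_hnorm.
  have := ler_norm (complex.Re (inner (T x) y)).
  have := sqr_ge0 (hnorm x - hnorm y); rewrite sqrrB => a b.
  rewrite mulr2n in a *; lra.
pose A := range J; pose m := inf A.
have mA : has_inf A.
  by split; [exists (J 0), 0|exists (- hnorm y ^+ 2) => _ [x _ <-]].
have m_lb x : m <= J x by apply: ge_inf; [case: mA|exists x].
have /choice[u hu] : forall n : nat, exists x, J x <= m + n.+1%:R^-1.
  move=> n; have [|_ [x _ <-] xm] := inf_adherent (_ : 0 < n.+1%:R^-1) mA.
    by rewrite invr_gt0.
  by exists x; exact: ltW.
have un n := riesz_near_min m_lb (hu n).
(* Both [u p] and [u q] nearly represent the same functional; test the two estimates on
   [h = u p - u q] and divide by [|h|]. *)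
have udist p q : hnorm (u p - u q) <= Num.sqrt p.+1%:R^-1 + Num.sqrt q.+1%:R^-1.
  set h := u p - u q; have [->|nz] := eqVneq (hnorm h) 0.
    by rewrite addr_ge0 ?sqrtr_ge0.
  have p0 : 0 < hnorm h by rewrite lt_def nz hnorm_ge0.
  rewrite -(ler_pM2r p0) -expr2 -lecR hnorm_sqr.
  rewrite -[leLHS]ger0_norm ?dnorm_ge0 // {2}/h innerBr.
  rewrite [(_ + _) * _]mulrDl rmorphD /=; have := lerD (un p h) (un q h); apply: le_trans.
  rewrite [X in _ <= _ + X]distrC; apply: le_trans (ler_normD _ _).
  by rewrite addrA subrK.
have [x ux] : exists x : H, u @ \oo --> x.
  apply: hnorm_complete => e e0.
  have [|N hN] := @exists_invS_lt R ((e / 2) ^+ 2); first by rewrite exprn_gt0 ?divr_gt0.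
  have e20 : 0 <= e / 2 by rewrite ltW ?divr_gt0.
  exists N => p q Np Nq; apply: le_lt_trans (udist p q) _.
  have e2 : 0 < (e / 2) ^+ 2 by rewrite exprn_gt0 ?divr_gt0.
  by rewrite [ltRHS]splitr ltrD // -[e / 2]ger0_norm // -sqrtr_sqr ltr_sqrt // hN.
exists x => h; apply/esym/eqP; rewrite -subr_eq0; apply/eqP.
apply: (norm_le_eps (hnorm_ge0 h)) => e e0; have e20 : 0 < e / 2 by rewrite divr_gt0.
have /cvgP_hnorm/(_ _ e20)[N1 hN1] := ux.
have [|N2 hN2] := @exists_invS_lt R ((e / 2) ^+ 2); first by rewrite exprn_gt0.
pose n := maxn N1 N2.
have -> : inner h x - inner (T h) y = inner h (x - u n) + (inner h (u n) - inner (T h) y).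
  by rewrite innerBr addrA subrK.
apply: le_trans (ler_normD _ _) _; rewrite [e]splitr mulrDl rmorphD; apply: lerD.
  apply: le_trans (inner_CauchySchwarz _ _) _.
  rewrite lecR mulrC; apply: ler_wpM2r; first exact: hnorm_ge0.
  by rewrite hnorm_distC; apply/ltW/hN1; rewrite leq_maxl.
apply: le_trans (un n h) _; rewrite lecR ler_wpM2r ?hnorm_ge0 // -[e / 2]ger0_norm ?(ltW e20)//.
by rewrite -sqrtr_sqr ler_wsqrtr // ltW // hN2 ?leq_maxr.
Qed.

End Riesz.

(** * Square roots of positive operators *)

Lemma hnorm_le_lim (R : realType) (H : hilbertType R) (u : nat -> H) l (b : R) :
  (u @ \oo --> l) -> (forall n, hnorm (u n) <= b) -> hnorm l <= b.
Proof.
move=> /cvg_hnorm ul ub; rewrite -(cvg_lim _ ul) //.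
by apply: limr_le; [apply/cvg_ex; eexists; exact: ul|exact: nearW].
Qed.

Lemma cvg_uniqueC (R : realType) (u : nat -> R[i]) (a b : R[i]) :
  (u @ \oo --> a) -> (u @ \oo --> b) -> a = b.
Proof. by move=> ua ub; rewrite -(cvg_lim _ ua) // -(cvg_lim _ ub). Qed.

(* [y n = (1 + y (n-1)^2) / 2] increases to [1]. The operators
   [Y n = (B + Y (n-1)^2) / 2] are polynomials in [B] with nonnegative
   coefficients, so their increments are dominated by those of [y]; their
   limit [Y] satisfies [(1 - Y)^2 = 1 - B]. *)
Section SquareRoot.
Variable R : realType.

Fixpoint sqrt_scalar (n : nat) : R :=
  if n is k.+1 then (1 + sqrt_scalar k ^+ 2) / 2 else 0.
Local Notation y := sqrt_scalar.

Lemma sqrt_scalar_ge0 n : 0 <= y n.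
Proof. by case: n => //= n; rewrite divr_ge0 // addr_ge0 // sqr_ge0. Qed.

Lemma sqrt_scalar_le1 n : y n <= 1.
Proof.
elim: n => [|n IH] /=; first exact: ler01.
rewrite ler_pdivrMr // mul1r (natrD _ 1 1) lerD2l exprn_ile1 //; exact: sqrt_scalar_ge0.
Qed.

(** The increment is [(1 - y n)^2 / 2]. *)
Lemma sqrt_scalarS n : y n <= y n.+1.
Proof. by have := sqr_ge0 (1 - y n) => /=; nra. Qed.

Lemma sqrt_scalar_mono m n : (m <= n)%N -> y m <= y n.
Proof.
move=> /subnKC <-; elim: (n - m)%N => [|k IH]; first by rewrite addn0.
by rewrite addnS (le_trans IH) // sqrt_scalarS.
Qed.

Lemma sqrt_scalar_cauchy (e : R) : 0 < e -> exists N, forall m n, (N <= m)%N ->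
  (m <= n)%N -> y n - y m < e.
Proof.
move=> e0; have /cvgrPdist_lt/(_ _ e0)[N _ hN] : cvgn y.
  apply: nondecreasing_is_cvgn; first by move=> m n; exact: sqrt_scalar_mono.
  by exists 1 => _ [n _ <-]; exact: sqrt_scalar_le1.
have yl n : y n <= limn y.
  apply: nondecreasing_cvgn_le; first by move=> p q; exact: sqrt_scalar_mono.
  apply: nondecreasing_is_cvgn; first by move=> p q; exact: sqrt_scalar_mono.
  by exists 1 => _ [p _ <-]; exact: sqrt_scalar_le1.
exists N => m n Nm mn; have := hN m Nm; rewrite /= => /(le_lt_trans (ler_norm _)).
have := yl n; lra.
Qed.

Variables (H : hilbertType R) (B : H -> H).
Hypotheses (B_contr : contractive B) (B_sa : adjoint B B).

Fixpoint sqrt_iter (n : nat) (x : H) : H :=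
  if n is k.+1 then (2^-1)%:C *: (B x + sqrt_iter k (sqrt_iter k x)) else 0.
Local Notation Y := sqrt_iter.

Lemma sqrt_iter_sa n : adjoint (Y n) (Y n).
Proof.
elim: n => [|n IH] x z /=; first by rewrite inner0l inner0r.
rewrite innerZl innerZr innerDl innerDr B_sa !IH.
by rewrite conj_real.
Qed.

Lemma sqrt_iter_linear n : linear (Y n).
Proof. exact: adjoint_linear (@sqrt_iter_sa n). Qed.

(** Taken first with [C = B] and then with [C = Y m], this makes all iterates commute. *)
Lemma sqrt_iter_comm (C : H -> H) n : linear C -> (forall x, C (B x) = B (C x)) ->
  forall x, C (Y n x) = Y n (C x).
Proof.
move=> Cl CB; elim: n => [|n IH] x /=; first by rewrite (lin0 Cl).
by rewrite (linZ Cl) (linD Cl) CB !IH.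
Qed.

Lemma sqrt_iterC m n x : Y m (Y n x) = Y n (Y m x).
Proof.
apply: sqrt_iter_comm => [|z]; first exact: sqrt_iter_linear.
apply/esym; apply: sqrt_iter_comm => //; exact: B_contr.1.
Qed.

Lemma sqrt_iter_le n x : hnorm (Y n x) <= y n * hnorm x.
Proof.
elim: n x => [|n IH] x /=; first by rewrite hnorm0 mul0r.
rewrite hnormZr ?invr_ge0 // mulrAC mulrC ler_wpM2r ?invr_ge0 //.
apply: le_trans (hnormD _ _) _; rewrite mulrDl mul1r lerD ?contractive_hnorm //.
apply: le_trans (IH _) _; rewrite expr2 -mulrA ler_wpM2l // sqrt_scalar_ge0 //.
Qed.

(** Since the iterates commute, the next increment is half of [(Y n.+1 - Y n) (Y n.+1 + Y n)]; the
    scalars factor in the same way, and the bounds multiply. *)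
Lemma sqrt_iter_step n x : hnorm (Y n.+1 x - Y n x) <= (y n.+1 - y n) * hnorm x.
Proof.
elim: n x => [|n IH] x.
  by rewrite [X in hnorm (_ - X)]/= !subr0; exact: (sqrt_iter_le 1).
set Z := fun z => Y n.+1 z - Y n z; pose w := Y n.+1 x + Y n x.
have -> : Y n.+2 x - Y n.+1 x = (2^-1)%:C *: Z w.
  have sE k z : Y k.+1 z = (2^-1)%:C *: (B z + Y k (Y k z)) by [].
  rewrite [Y n.+2 x]sE [X in _ - X = _]sE -scalerBr; congr (_ *: _).
  rewrite /Z /w !(linD (@sqrt_iter_linear _)) (sqrt_iterC n n.+1).
  by rewrite [in LHS]opprD addrACA subrr add0r opprD addrA addrK.
rewrite hnormZr ?invr_ge0 //; have Zw := IH w.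
have ww : hnorm w <= (y n.+1 + y n) * hnorm x.
  by rewrite mulrDl (le_trans (hnormD _ _)) // lerD // sqrt_iter_le.
have d0 : 0 <= y n.+1 - y n by rewrite subr_ge0 sqrt_scalarS.
have -> : y n.+2 - y n.+1 = 2^-1 * ((y n.+1 - y n) * (y n.+1 + y n)).
  have yE k : y k.+1 = (1 + y k ^+ 2) / 2 by [].
  by rewrite [y n.+2]yE [X in _ - X = _]yE; field.
rewrite -!mulrA ler_wpM2l ?invr_ge0 //; apply: le_trans Zw _.
by rewrite ler_wpM2l.
Qed.

Lemma sqrt_iter_dist m n x : (m <= n)%N -> hnorm (Y n x - Y m x) <= (y n - y m) * hnorm x.
Proof.
move=> /subnKC <-; elim: (n - m)%N => [|k IH].
  by rewrite addn0 !subrr hnorm0 mul0r.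
rewrite addnS -(subrKA (Y (m + k) x)) -[y _ - _](subrKA (y (m + k))) mulrDl.
by apply: le_trans (hnormD _ _) _; rewrite lerD // sqrt_iter_step.
Qed.

Lemma sqrt_iter_cvg x : exists l : H, Y^~ x @ \oo --> l.
Proof.
apply: hnorm_complete => e e0; have x1 : 0 < hnorm x + 1 by rewrite ltr_wpDl ?hnorm_ge0.
have [N hN] := sqrt_scalar_cauchy (divr_gt0 e0 x1).
have cN m n : (N <= m)%N -> (m <= n)%N -> hnorm (Y n x - Y m x) < e.
  move=> Nm mn; apply: le_lt_trans (sqrt_iter_dist _ mn) _.
  have := hN m n Nm mn; rewrite ltr_pdivlMr //; apply: le_lt_trans.
  by rewrite ler_wpM2l ?lerDl // subr_ge0 sqrt_scalar_mono.
exists N => m n Nm Nn; have [mn|/ltnW nm] := leqP m n; last exact: cN.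
by rewrite hnorm_distC cN.
Qed.

(** The root is [1 - Z] with [Z] the strong limit of the iterates. As [Z] is a self-adjoint
    contraction, [<Z x, x>] is real and at most [|x|^2], which gives positivity. *)
Lemma exists_sqrt : exists S : H -> H, positive_op S /\ forall x, S (S x) = x - B x.
Proof.
have /choice[Z Yc] := sqrt_iter_cvg.
have Z_sa : adjoint Z Z.
  move=> x z; apply: (@cvg_uniqueC _ (fun n => inner (Y n x) z)); first exact: cvg_innerl.
  by under eq_fun do rewrite sqrt_iter_sa; exact: cvg_innerr.
have Zl := adjoint_linear Z_sa.
have Yle n x : hnorm (Y n x) <= hnorm x.
  by apply: le_trans (sqrt_iter_le _ _) _; rewrite ler_piMl ?hnorm_ge0 // sqrt_scalar_le1.
have Zle x : hnorm (Z x) <= hnorm x by apply: hnorm_le_lim (Yc x) _ => n; exact: Yle.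
have Zc : contractive Z by split=> // x; rewrite hnorm_norm.
have ZZ x : Z x = (2^-1)%:C *: (B x + Z (Z x)).
  (* Split the difference as [Y n (Y n x - Z x) + (Y n (Z x) - Z (Z x))]; the uniform bound [Yle]
     controls the first term. *)
  have YY : (fun n => Y n (Y n x)) @ \oo --> Z (Z x).
    apply/cvgP_hnorm => e e0; have e20 : 0 < e / 2 by rewrite divr_gt0.
    have /cvgP_hnorm/(_ _ e20)[N1 hN1] := Yc x.
    have /cvgP_hnorm/(_ _ e20)[N2 hN2] := Yc (Z x).
    exists (maxn N1 N2) => n; rewrite geq_max => /andP[n1 n2].
    rewrite -(subrKA (Y n (Z x))) -(linB (@sqrt_iter_linear n)).
    apply: le_lt_trans (hnormD _ _) _; rewrite [ltRHS]splitr ltrD ?hN2 //.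
    by apply: le_lt_trans (Yle _ _) _; exact: hN1.
  apply: inner_injr => z.
  apply: (@cvg_uniqueC _ (fun n => inner z (Y n.+1 x))).
    by apply: cvg_innerr; rewrite (cvg_shiftS (fun n => Y n x)); exact: Yc.
  apply: cvg_innerr => /=; apply: cvgZr; apply: cvgD YY; exact: cvg_cst.
pose S x := x - Z x; exists S; split; last first.
  (* The fixed point equation [ZZ], solved for [B], says [1 - B = (1 - Z)^2]. *)
  move=> x; have -> : B x = Z x + Z x - Z (Z x).
    rewrite {1 2}ZZ -scalerDl -rmorphD /= (_ : 2^-1 + 2^-1 = 1 :> R); last by field.
    by rewrite scale1r addrK.
  by rewrite /S (linB Zl) -[LHS]addrA -opprD addrA.
split.
  split; first by move=> a x z; rewrite /S Zl opprD scalerBr addrACA.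
  move=> x; apply: cvgB; [exact: cvg_id|exact: contractive_continuous].
move=> x; rewrite /S innerBl.
have Rx : inner (Z x) x \is Num.real by rewrite CrealE -innerC Z_sa.
rewrite subr_ge0; apply: le_trans (real_ler_norm Rx) _.
apply: le_trans (inner_CauchySchwarz _ _) _.
by rewrite -hnorm_sqr lecR expr2 ler_wpM2r ?hnorm_ge0.
Qed.
End SquareRoot.

(** * Defect operators *)

Section Defect.
Variable R : realType.

Lemma contractive_comp (H K L : hilbertType R) (f : K -> L) (g : H -> K) :
  contractive f -> contractive g -> contractive (f \o g).
Proof.
move=> [fl fc] [gl gc]; split=> [a x z|x] /=; first by rewrite gl fl.
exact: le_trans (fc _) (gc _).
Qed.

Lemma adj_adjoint (H K : hilbertType R) (T : H -> K) : contractive T -> adjoint T (adj T).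
Proof. by move=> /exists_adjoint[T' TT']; rewrite (adjoint_adj TT'). Qed.

(** Polarisation: the quadratic form is real at [x], [z], [x + z] and [x + i z], and the vanishing
    imaginary parts give [<S x, z> = conj <S z, x>]. *)
Lemma positive_op_selfadjoint (H : hilbertType R) (S : H -> H) : positive_op S -> adjoint S S.
Proof.
move=> [[Sl _] S0] x z; rewrite (innerC x).
have im0 (w : R[i]) : 0 <= w -> complex.Im w = 0 by rewrite lecE => /andP[/eqP].
have := S0 (x + z); have := S0 (x + 'i *: z); have := S0 x; have := S0 z.
rewrite !(linD Sl) !(linZ Sl) !(innerDl, innerDr, innerZl, innerZr).
case: (inner (S x) x) => a a'; case: (inner (S z) z) => b b'.
case: (inner (S x) z) => c c'; case: (inner (S z) x) => d d'.
move=> /im0/= h1 /im0/= h2 /im0/= h3 /im0/= h4.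
by apply/eqP; rewrite eq_complex /=; apply/andP; split; apply/eqP; lra.
Qed.

Variables (H : hilbertType R) (T : H -> H).
Hypothesis T_contr : contractive T.

(** The operator [T \o adj T] is a self-adjoint contraction, so [1 - T \o adj T] has a positive root
    and the choice in [sqrt_op] does not fall back on its default. *)
Lemma defect_opP : positive_op (defect_op T) /\
  forall x, defect_op T (defect_op T x) = x - T (adj T x).
Proof.
have TT' := adj_adjoint T_contr; have T'_contr := adjoint_contractive T_contr TT'.
have [||S hS] := @exists_sqrt _ _ (T \o adj T); first exact: contractive_comp.
  by move=> x z /=; rewrite TT' (adjoint_sym TT').
exact: (@xgetPex _ (fun=> 0) [set S | positive_op S /\ forall x, S (S x) = x - T (adj T x)] (ex_intro _ S hS)).
Qed.

Lemma defect_op_inner g h :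
  inner (defect_op T g) (defect_op T h) = inner g h - inner (adj T g) (adj T h).
Proof.
have [/positive_op_selfadjoint D_sa DD] := defect_opP.
by rewrite D_sa DD innerBr (adjoint_sym (adj_adjoint T_contr)).
Qed.

Lemma defect_op_mem h : defect_op T h \in in_closedSubspace (closed_range (defect_op T)).
Proof. by apply/mem_set/subset_closure; exists h. Qed.

Definition defect_map (h : H) : defect_space T := Sub (defect_op T h) (defect_op_mem h).

Lemma defect_map_linear : linear defect_map.
Proof. by move=> a x z; apply: val_inj; rewrite /= linearP. Qed.

Lemma defect_map_inner g h :
  inner (defect_map g) (defect_map h) = inner g h - inner (adj T g) (adj T h).
Proof. exact: defect_op_inner. Qed.

(** Approximate [y] by some [defect_map h]; then [|y|^2 = <y - defect_map h, y>] is arbitrarily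
    small. *)
Lemma defect_map_dense y : (forall h, inner (defect_map h) y = 0) -> y = 0.
Proof.
move=> y0; apply: inner_eq0; apply: (norm_le_eps (hnorm_ge0 y)) => e e0.
have /set_mem/= := valP y => /(_ _ (nbhsx_ballx _ _ (_ : 0 < e%:C)))[|_ [[h _ <-]]].
  by rewrite ltcR.
rewrite -ball_normE /= => yh.
have -> : inner y y = inner (y - defect_map h) y by rewrite innerBl y0 subr0.
apply: le_trans (inner_CauchySchwarz _ _) _; rewrite lecR ler_wpM2r ?hnorm_ge0 //.
rewrite -lecR hnormE.
have -> : `|y - defect_map h| = `|val y - defect_op T h|.
  by apply/eqP; rewrite -(@eqrXn2 _ 2) // -!innerxx.
exact: ltW.
Qed.
End Defect.

(** * Finite orthonormal families and extension of isometries *)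

Section FiniteOrthonormal.
Variables (R : realType) (E : hilbertType R).
Implicit Types (s t l : seq E) (x y : E).

Definition orthonormal_seq s := forall i j, (i < size s)%N -> (j < size s)%N ->
  inner s`_i s`_j = (i == j)%:R.

Definition orthogonal_to y s := forall i, (i < size s)%N -> inner y s`_i = 0.

(** Spanning is expressed by a trivial orthogonal complement, a form that passes directly through
    Gram-Schmidt and to direct sums. *)
Definition total_seq s := forall y, orthogonal_to y s -> y = 0.

Definition fourier_sum s x := \sum_(i < size s) inner x s`_i *: s`_i.

Lemma inner_suml I (r : seq I) (P : pred I) (F : I -> E) y :
  inner (\sum_(i <- r | P i) F i) y = \sum_(i <- r | P i) inner (F i) y.
Proof. exact: linear_sumlz. Qed.

Lemma inner_sumr I (r : seq I) (P : pred I) (F : I -> E) y :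
  inner y (\sum_(i <- r | P i) F i) = \sum_(i <- r | P i) inner y (F i).
Proof. exact: linear_sumr. Qed.

Lemma orthonormal_comb s n (c : nat -> R[i]) j : orthonormal_seq s -> (n <= size s)%N -> (j < n)%N ->
  inner (\sum_(i < n) c i *: s`_i) s`_j = c j.
Proof.
move=> os ns jn; rewrite inner_suml (bigD1 (Ordinal jn)) //= innerZl os ?(leq_trans jn) // eqxx mulr1.
rewrite big1 ?addr0 // => i; rewrite -val_eqE /= => /negPf ij.
by rewrite innerZl os ?(leq_trans _ ns) // ij mulr0.
Qed.

Lemma fourier_sum_inner s x i : orthonormal_seq s -> (i < size s)%N ->
  inner (fourier_sum s x) s`_i = inner x s`_i.
Proof. by move=> os i_s; rewrite (orthonormal_comb (fun i => inner x s`_i)). Qed.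

Lemma fourier_residual s x : orthonormal_seq s -> orthogonal_to (x - fourier_sum s x) s.
Proof. by move=> os i i_s; rewrite innerBl fourier_sum_inner // subrr. Qed.

Lemma fourier_total s x : orthonormal_seq s -> total_seq s -> fourier_sum s x = x.
Proof.
move=> os ts; apply/esym/eqP; rewrite -subr_eq0; apply/eqP/ts; exact: fourier_residual.
Qed.

Lemma fourier_sum_sqr s x : orthonormal_seq s ->
  hnorm (fourier_sum s x) ^+ 2 = \sum_(i < size s) complex.Re (`|inner x s`_i| ^+ 2).
Proof.
move=> os; apply: complexI; rewrite hnorm_sqr rmorph_sum {1}/fourier_sum inner_suml.
apply: eq_bigr => i _; rewrite innerZl (innerC _ (fourier_sum s x)) fourier_sum_inner //.
rewrite -normCK; apply: esym; apply: complexRe_ge0; exact: exprn_ge0.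
Qed.

Lemma bessel s x : orthonormal_seq s -> hnorm (fourier_sum s x) <= hnorm x.
Proof.
move=> os; rewrite hnorm_le_sqr -lecR !hnorm_sqr.
have h : inner (x - fourier_sum s x) (fourier_sum s x) = 0.
  rewrite {2}/fourier_sum inner_sumr big1 // => i _.
  by rewrite innerZr (fourier_residual x os) // mulr0.
by have := hnormDd h; rewrite subrK => ->; rewrite lerDr dnorm_ge0.
Qed.

Lemma orthonormal_norm1 s i : orthonormal_seq s -> (i < size s)%N -> hnorm s`_i = 1.
Proof.
move=> os i_s; apply/eqP; rewrite -(@eqrXn2 _ 2) ?hnorm_ge0 //; apply/eqP/complexI.
by rewrite hnorm_sqr os // eqxx expr1n.
Qed.

(** Sum [|<s_i, t_j>|^2] in two ways: Parseval along the total family [t] gives [size s], and Bessel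
    along [s] gives at most [size t]. *)
Lemma orthonormal_size_le s t : orthonormal_seq s -> orthonormal_seq t -> total_seq t ->
  (size s <= size t)%N.
Proof.
move=> os ot tt; rewrite -(ler_nat R).
have -> : (size s)%:R = \sum_(i < size s) \sum_(j < size t) complex.Re (`|inner s`_i t`_j| ^+ 2).
  transitivity (\sum_(i < size s) (1 : R)); first by rewrite sumr_const card_ord.
  apply: eq_bigr => i _.
  by rewrite -fourier_sum_sqr // fourier_total // orthonormal_norm1 // expr1n.
rewrite exchange_big [leRHS](_ : _ = \sum_(j < size t) (1 : R)); last by rewrite sumr_const card_ord.
apply: ler_sum => j _.
have : hnorm (fourier_sum s t`_j) ^+ 2 <= 1.
  have := bessel t`_j os; rewrite hnorm_le_sqr (orthonormal_norm1 ot (ltn_ord j)).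
  by rewrite (expr1n R 2).
rewrite fourier_sum_sqr //; apply: le_trans; rewrite le_eqVlt; apply/orP; left; apply/eqP/eq_bigr => i _.
by rewrite (innerC s`_i) norm_conjC.
Qed.

Lemma orthonormal_rcons s y : orthonormal_seq s -> orthogonal_to y s -> hnorm y = 1 ->
  orthonormal_seq (rcons s y).
Proof.
move=> os oy y1 i j; rewrite size_rcons !ltnS !nth_rcons.
case: (ltngtP i (size s)) => // [i_s|->] _; case: (ltngtP j (size s)) => // [j_s|j_s] _.
- exact: os.
- by rewrite innerC oy // conjC0 j_s ltn_eqF.
- by rewrite oy.
- by rewrite ?eqxx -hnorm_sqr y1 expr1n.
Qed.

Lemma hnorm_normalize y : y != 0 -> hnorm ((hnorm y)^-1%:C *: y) = 1.
Proof.
move=> y0; rewrite hnormZr ?invr_ge0 ?hnorm_ge0 // mulVf //.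
by apply: contra y0 => /eqP/hnorm_eq0 ->.
Qed.

(** Each nonzero residual of a vector of [l] is normalised and appended. That [l] lies in the
    resulting span is recorded dually, through orthogonality. *)
Lemma gram_schmidt s l : orthonormal_seq s -> exists s', orthonormal_seq (s ++ s') /\
  forall y, orthogonal_to y (s ++ s') -> orthogonal_to y l.
Proof.
elim: l s => [|x l IH] s os; first by exists [::]; rewrite cats0; split.
pose r := x - fourier_sum s x; have [r0|r0] := eqVneq r 0.
  have [s' [os' hs']] := IH s os; exists s'; split=> // y oy [|i] /= il; last exact: hs'.
  have -> : x = fourier_sum s x by apply/eqP; rewrite -subr_eq0 -/r r0.
  rewrite inner_sumr big1 // => i _; rewrite innerZr.
  have := oy i; rewrite nth_cat ltn_ord => ->; first by rewrite mulr0.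
  by rewrite size_cat ltn_addr.
pose e := (hnorm r)^-1%:C *: r.
have oe : orthonormal_seq (rcons s e).
  apply: orthonormal_rcons => //; last exact: hnorm_normalize.
  by move=> i i_s; rewrite innerZl fourier_residual // mulr0.
have [s' [os' hs']] := IH _ oe; exists (e :: s'); rewrite -cat_rcons; split=> //.
move=> y oy [|i] /= il; last exact: hs'.
have -> : x = (hnorm r)%:C *: e + fourier_sum s x.
  rewrite scalerA -rmorphM /= divff ?scale1r ?subrK //.
  by apply: contra r0 => /eqP/hnorm_eq0 ->.
have oy' i0 : (i0 < size (rcons s e))%N -> inner y (rcons s e)`_i0 = 0.
  move=> h; have := oy i0; rewrite nth_cat h => -> //; by rewrite size_cat ltn_addr.
rewrite innerDr innerZr; have := oy' (size s); rewrite size_rcons nth_rcons ltnn eqxx => -> //.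
rewrite mulr0 add0r inner_sumr big1 // => j _; rewrite innerZr.
have := oy' j; rewrite size_rcons nth_rcons ltn_ord => ->; first by rewrite mulr0.
by rewrite ltnS ltnW.
Qed.

Lemma orthonormal_extend s t : orthonormal_seq s -> total_seq t ->
  exists s', orthonormal_seq (s ++ s') /\ total_seq (s ++ s').
Proof.
move=> os tt; have [s' [os' hs']] := gram_schmidt t os.
by exists s'; split=> // y /hs'; exact: tt.
Qed.

Lemma finite_dimensional_total : finite_dimensional E -> exists t, total_seq t.
Proof.
move=> [n [e he]]; exists [seq e i | i <- enum 'I_n] => y oy.
have oe i : inner y (e i) = 0.
  have := oy i; rewrite size_map size_enum_ord => /(_ (ltn_ord i)).
  by rewrite (nth_map i) ?size_enum_ord // nth_ord_enum.
apply: inner_eq0; have [c hc] := he y; rewrite {2}hc inner_sumr big1 // => i _.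
by rewrite innerZr oe mulr0.
Qed.

Variables (H : hilbertType R).

(** An orthonormal basis of the range of [a], kept as preimages [g] so that a second map can be
    evaluated on them. It is an orthonormal family in the range of maximal length; the basis [t'] of
    [E] bounds all such lengths. *)
Lemma orthonormal_range (a : H -> E) t : linear a -> total_seq t ->
  exists g : seq H, orthonormal_seq (map a g) /\ forall h, fourier_sum (map a g) (a h) = a h.
Proof.
move=> al tt; have [t' [ot' tt']] := @orthonormal_extend [::] t (fun i j => ltac:(by [])) tt.
pose ok n := `[< exists g : seq H, size g = n /\ orthonormal_seq (map a g) >].
have ok0 : exists n, ok n by exists 0%N; apply/asboolP; exists [::]; split=> // i j.
have okb n : ok n -> (n <= size t')%N.
  by move=> /asboolP[g [<- og]]; rewrite -(size_map a); exact: orthonormal_size_le.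
case: (ex_maxnP ok0 okb) => n /asboolP[g [gn og]] nmax; exists g; split=> // h.
apply/eqP; rewrite eq_sym -subr_eq0; apply/negP => /negP r0.
(* The residual is [a k], so a nonzero residual would yield a longer family still inside the range
   of [a]. *)
pose k := h - \sum_(i < size g) inner (a h) (a g`_i) *: g`_i.
have ak : a k = a h - fourier_sum (map a g) (a h).
  rewrite (linB al); congr (_ - _); rewrite (lin_sum al) /fourier_sum size_map.
  by apply: eq_bigr => i _; rewrite (linZ al) (nth_map 0).
have := nmax n.+1; rewrite ltnn => /(_ _)/negP; apply => //; apply/asboolP.
exists (rcons g ((hnorm (a k))^-1%:C *: k)); rewrite size_rcons gn; split=> //.
rewrite map_rcons (linZ al); apply: orthonormal_rcons => //.
  by move=> i i_s; rewrite innerZl ak fourier_residual // mulr0.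
by apply: hnorm_normalize; rewrite ak.
Qed.

(** The families [map a g] and [map b g] are both orthonormal because the Gram forms agree.
    Completing each to an orthonormal basis of [E] gives [u] and [u'] of equal length, and [W] sends
    [u_i] to [u'_i]. *)
Lemma unitary_extension (a b : H -> E) t : linear a -> linear b -> total_seq t ->
  (forall g h, inner (a g) (a h) = inner (b g) (b h)) ->
  exists W W' : E -> E, [/\ adjoint W W', cancel W W', cancel W' W & forall h, W (a h) = b h].
Proof.
move=> al bl tt ab; have [g [ag hg]] := orthonormal_range al tt.
have bg : orthonormal_seq (map b g).
  move=> i j; rewrite size_map => ig jg; rewrite !(nth_map 0) // -ab.
  by have := ag i j; rewrite size_map !(nth_map 0) //; exact.
have [s [os ts]] := orthonormal_extend ag tt; have [s' [os' ts']] := orthonormal_extend bg tt.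
set u := _ ++ s in os ts; set u' := _ ++ s' in os' ts'.
have uu' : size u = size u' by apply/eqP; rewrite eqn_leq !orthonormal_size_le.
have main (v v' : seq E) : orthonormal_seq v -> total_seq v -> orthonormal_seq v' -> size v = size v' ->
    cancel (fun x => \sum_(i < size v) inner x v`_i *: v'`_i)
           (fun x => \sum_(i < size v) inner x v'`_i *: v`_i).
  move=> ov tv ov' vv' x; rewrite -[RHS](fourier_total x ov tv); apply: eq_bigr => i _.
  by rewrite (orthonormal_comb (fun i => inner x v`_i)) // -vv'.
exists (fun x => \sum_(i < size u) inner x u`_i *: u'`_i).
exists (fun x => \sum_(i < size u) inner x u'`_i *: u`_i); split.
- move=> x y; rewrite inner_suml inner_sumr; apply: eq_bigr => i _.
  by rewrite innerZl innerZr -(innerC u'`_i) mulrC.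
- exact: main.
- by rewrite uu'; apply: main.
move=> h; rewrite -[in LHS]hg.
(* The expansion of [a h] transfers to [b h]: the residual [k] satisfies [a k = 0], hence
   [|b k| = |a k| = 0]. *)
have -> : b h = \sum_(i < size (map a g)) inner (a h) (map a g)`_i *: (map b g)`_i.
  rewrite size_map; apply/eqP; rewrite -subr_eq0.
  pose k := h - \sum_(i < size g) inner (a h) (map a g)`_i *: g`_i.
  have -> : b h - \sum_(i < size g) inner (a h) (map a g)`_i *: (map b g)`_i = b k.
    rewrite (linB bl); congr (_ - _); rewrite (lin_sum bl).
    by apply: eq_bigr => i _; rewrite (linZ bl) (nth_map 0 0 b).
  apply/eqP/inner_eq0; rewrite -ab; suff -> : a k = 0 by rewrite inner0l.
  apply/eqP; rewrite (linB al) subr_eq0 -[X in X == _]hg /fourier_sum size_map (lin_sum al); apply/eqP.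
  by apply: eq_bigr => i _; rewrite (linZ al) (nth_map 0 0 a).
(* Pad the sum to the whole basis: [a h] has zero coefficients on the added vectors. *)
have ku : (size (map a g) <= size u)%N by rewrite size_cat leq_addr.
rewrite (big_ord_widen _ (fun i => inner (a h) (map a g)`_i *: (map b g)`_i) ku) [RHS]big_mkcond /=.
apply: eq_bigr => i _.
have -> : inner (fourier_sum (map a g) (a h)) u`_i =
    if (i < size (map a g))%N then inner (a h) (map a g)`_i else 0.
  case: ifP => ig; first by rewrite hg /u nth_cat ig.
  rewrite /fourier_sum inner_suml big1 // => j _; rewrite innerZl.
  have <- : u`_j = (map a g)`_j by rewrite /u nth_cat ltn_ord.
  rewrite os ?ltn_ord //; last by rewrite (leq_trans (ltn_ord j)).
  case: eqP => [ji|]; last by rewrite mulr0.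
  by move: ig; rewrite -ji ltn_ord.
case: ifP => ig; last by rewrite scale0r.
by rewrite /u' nth_cat; move: ig; rewrite !size_map => ->.
Qed.

End FiniteOrthonormal.

(** * Inner products and total families in direct sums *)

Lemma inner_hsum (R : realType) (E F : hilbertType R) (x y : hsum E F) :
  inner x y = inner x.1 y.1 + inner x.2 y.2.
Proof. by []. Qed.

Lemma inner_hsum_pair (R : realType) (E F : hilbertType R) (x x' : E) (y y' : F) :
  inner ((x, y) : hsum E F) (x', y') = inner x x' + inner y y'.
Proof. by []. Qed.

Lemma total_seq_hsum (R : realType) (E F : hilbertType R) (s : seq E) (t : seq F) :
  total_seq s -> total_seq t -> exists u : seq (hsum E F), total_seq u.
Proof.
move=> ts tt; exists ([seq ((x, 0) : hsum E F) | x <- s] ++ [seq ((0, y) : hsum E F) | y <- t]).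
case=> x y oxy; congr (_, _).
  apply: ts => i i_s; have := oxy i; rewrite size_cat !size_map nth_cat size_map i_s (nth_map 0) //.
  by rewrite ltn_addr // => /(_ isT); rewrite inner_hsum_pair inner0r addr0.
apply: tt => i i_t; have := oxy (size s + i)%N.
rewrite size_cat !size_map ltn_add2l nth_cat size_map (ltnNge _ (size s)) leq_addr addKn (nth_map (0 : F)) //.
move=> /(_ i_t) h; have : inner x 0 + inner y t`_i = 0 by exact: h.
by rewrite inner0r add0r.
Qed.

(** * Operators on the Hardy space *)

Section Limits.
Variables (R : realType) (E : hilbertType R).

Lemma cvg_contractive (F : hilbertType R) (A : E -> F) (u : nat -> E) (l : E) :
  contractive A -> (u @ \oo --> l) -> (fun n => A (u n)) @ \oo --> A l.
Proof.
move=> hA /cvgP_hnorm ul; apply/cvgP_hnorm => e /ul[N hN]; exists N => n /hN.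
by rewrite -(linB hA.1); apply: le_lt_trans; exact: contractive_hnorm.
Qed.

Lemma hnorm_sum_le I (r : seq I) (P : pred I) (F : I -> E) :
  hnorm (\sum_(i <- r | P i) F i) <= \sum_(i <- r | P i) hnorm (F i).
Proof.
elim/big_rec2 : _ => [|i b x _ h]; first by rewrite hnorm0.
by apply: le_trans (hnormD _ _) _; rewrite lerD2l.
Qed.

Lemma hnorm_series_cvg (u : nat -> E) (w : nat -> R) :
  (forall k, hnorm (u k) <= w k) -> cvgn (series w) ->
  exists l : E, (series u @ \oo --> l) /\ hnorm l <= limn (series w).
Proof.
move=> uw cw; have w0 k : 0 <= w k by exact: le_trans (hnorm_ge0 _) (uw k).
have wl n : series w n <= limn (series w).
  by apply: nondecreasing_cvgn_le => //; apply: nondecreasing_series => k _ _.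
have dist m n : (m <= n)%N -> hnorm (series u n - series u m) <= series w n - series w m.
  move=> mn; rewrite !sub_series_geq //; apply: le_trans (hnorm_sum_le _ _ _) _.
  by apply: ler_sum => k _; exact: uw.
have [l ul] : exists l : E, series u @ \oo --> l.
  apply: hnorm_complete => e e0; have /cvgrPdist_lt/(_ _ e0)[N _ hN] := cw.
  have cN m n : (N <= m)%N -> (m <= n)%N -> hnorm (series u n - series u m) < e.
    move=> Nm mn; apply: le_lt_trans (dist _ _ mn) _.
    have := hN m Nm; rewrite /= => /(le_lt_trans (ler_norm _)); apply: le_lt_trans.
    by rewrite lerD2r.
  exists N => m n Nm Nn; have [mn|/ltnW nm] := leqP m n; last exact: cN.
  by rewrite hnorm_distC cN.
exists l; split=> //; apply: hnorm_le_lim ul _ => n.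
apply: le_trans (wl n); rewrite /series /=; apply: le_trans (hnorm_sum_le _ _ _) _.
by apply: ler_sum => k _; exact: uw.
Qed.

End Limits.

Section H2Operators.
Variables (R : realType) (E : hilbertType R).
Implicit Types (f g : H2 E) (A B : E -> E).

Lemma H2_val_inj f g : (forall k, val f k = val g k) -> f = g.
Proof. by move=> fg; apply/val_inj/funext. Qed.

Lemma H2_valD f g k : val (f + g) k = val f k + val g k. Proof. by []. Qed.
Lemma H2_valB f g k : val (f - g) k = val f k - val g k. Proof. by []. Qed.

Lemma hnorm_H2 f : hnorm f ^+ 2 = H2_sqr f.
Proof. by apply: complexI; rewrite hnorm_sqr -H2_innerxx. Qed.

Lemma H2_hnorm_le f (b : R) : (forall n, \sum_(0 <= k < n) hnorm (val f k) ^+ 2 <= b) ->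
  hnorm f ^+ 2 <= b.
Proof.
by move=> h; rewrite hnorm_H2; apply: limr_le; [exact: H2_summable|exact: nearW].
Qed.

Lemma mem_H2 (u : nat -> E) (b : R) :
  (forall n, \sum_(0 <= k < n) hnorm (u k) ^+ 2 <= b) -> u \in @in_H2 R E.
Proof.
move=> h; apply/mem_set; apply: nondecreasing_is_cvgn.
  by apply: nondecreasing_series => k _ _; exact: sqr_ge0.
by exists b => _ [n _ <-]; exact: h.
Qed.

Definition H2_of (u : nat -> E) (hu : u \in @in_H2 R E) : H2 E :=
  exist (fun v : nat -> E => v \in @in_H2 R E) u hu.

(** The default 0 would only appear if the image were not square summable; for contractive [A] this
    never happens. *)
Definition H2_map A f : H2 E := insubd 0 (fun k => A (val f k)).

Lemma H2_mapE A f k : contractive A -> val (H2_map A f) k = A (val f k).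
Proof.
move=> hA; rewrite /H2_map insubdK //; apply: (@mem_H2 _ (H2_sqr f)) => n.
apply: le_trans (H2_partial_le f n); apply: ler_sum => j _.
by rewrite -hnorm_le_sqr contractive_hnorm.
Qed.

Lemma H2_shift_subproof f : (fun k => if k is j.+1 then val f j else 0) \in @in_H2 R E.
Proof.
apply: (@mem_H2 _ (H2_sqr f)) => -[|n]; first by rewrite big_geq // -hnorm_H2 sqr_ge0.
by rewrite big_nat_recl //= hnorm0 expr0n add0r; exact: H2_partial_le.
Qed.
Definition H2_shift f : H2 E := H2_of (H2_shift_subproof f).

Lemma H2_backshift_subproof f : (fun k => val f k.+1) \in @in_H2 R E.
Proof.
apply: (@mem_H2 _ (H2_sqr f)) => n; apply: le_trans (H2_partial_le f n.+1).
by rewrite big_nat_recl //= lerDr sqr_ge0.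
Qed.
Definition H2_backshift f : H2 E := H2_of (H2_backshift_subproof f).

Lemma H2_map_adjoint A A' : contractive A -> contractive A' -> adjoint A A' ->
  adjoint (H2_map A) (H2_map A').
Proof.
move=> hA hA' AA' f g; congr (limn (series _)); apply/funext => k.
by rewrite !H2_mapE.
Qed.

Lemma H2_shift_adjoint : adjoint H2_shift H2_backshift.
Proof.
move=> f g; apply: cvg_lim => //.
rewrite -(cvg_shiftS (series _)) (_ : (fun n => _) = series (fun k => inner (val f k) (val (H2_backshift g) k))).
  exact: H2_inner_cvg.
apply/funext => n; rewrite /series /= big_nat_recl //= inner0l add0r //.
Qed.

(** * Evaluation at a point of the disc *)

Section Evaluation.
Variable z : R[i].
Hypothesis z1 : `|z| < 1.
Let r : R := complex.Re `|z|.

Let rE : r%:C = `|z|. Proof. exact: complexRe_ge0. Qed.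
Let r0 : 0 <= r. Proof. by rewrite -ler0c rE. Qed.
Let r1 : r < 1. Proof. by rewrite -ltcR rE. Qed.

(** Every coefficient is bounded by [hnorm f], so a geometric series of ratio [r] dominates the
    power series. *)
Lemma H2_eval_bounded f : exists l : E, (series (fun k => z ^+ k *: val f k) @ \oo --> l) /\
  hnorm l <= hnorm f * (1 - r)^-1.
Proof.
have r1' : `|r| < 1 by rewrite ger0_norm.
have [k||l [ul hl]] := @hnorm_series_cvg _ _ (fun k => z ^+ k *: val f k) (geometric (hnorm f) r).
- rewrite hnormZ normrX -rE -rmorphXn /= mulrC ler_wpM2r ?exprn_ge0 //.
  by rewrite hnorm_le_sqr hnorm_H2 H2_coord_le.
- by apply/cvg_ex; eexists; exact: cvg_geometric_series.
exists l; split=> //; apply: le_trans hl _.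
by rewrite (cvg_lim _ (cvg_geometric_series r1')).
Qed.

Lemma H2_eval_eq f (l : E) : (series (fun k => z ^+ k *: val f k) @ \oo --> l) -> H2_eval f z = l.
Proof. by move=> h; apply: cvg_lim h; exact: norm_hausdorff. Qed.

Lemma H2_eval_cvg f : series (fun k => z ^+ k *: val f k) @ \oo --> H2_eval f z.
Proof. by have [l [ul _]] := H2_eval_bounded f; rewrite (H2_eval_eq ul). Qed.

Lemma H2_eval_le f : hnorm (H2_eval f z) <= hnorm f * (1 - r)^-1.
Proof. by have [l [ul hl]] := H2_eval_bounded f; rewrite (H2_eval_eq ul). Qed.

Lemma H2_evalD f g : H2_eval (f + g) z = H2_eval f z + H2_eval g z.
Proof.
apply: H2_eval_eq; rewrite (_ : series _ = fun n =>
  series (fun k => z ^+ k *: val f k) n + series (fun k => z ^+ k *: val g k) n).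
  by apply: cvgD; exact: H2_eval_cvg.
apply/funext => n; rewrite /series /= -big_split /=; apply: eq_bigr => k _.
by rewrite -scalerDr.
Qed.

Lemma H2_eval_map A f : contractive A -> H2_eval (H2_map A f) z = A (H2_eval f z).
Proof.
move=> hA; apply: H2_eval_eq; rewrite (_ : series _ = fun n => A (series (fun k => z ^+ k *: val f k) n)).
  by apply: cvg_contractive => //; exact: H2_eval_cvg.
apply/funext => n; rewrite /series /= (lin_sum hA.1); apply: eq_bigr => k _.
by rewrite H2_mapE // (linZ hA.1).
Qed.

Lemma H2_eval_shift f : H2_eval (H2_shift f) z = z *: H2_eval f z.
Proof.
apply: H2_eval_eq; rewrite -(cvg_shiftS (series _)) (_ : (fun n => _) = fun n => z *: series (fun k => z ^+ k *: val f k) n).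
  by apply: cvgZr; exact: H2_eval_cvg.
apply/funext => n; rewrite /series /= big_nat_recl //= scaler0 add0r scaler_sumr.
by apply: eq_bigr => k _; rewrite exprS scalerA.
Qed.

Lemma H2_eval_recl f : H2_eval f z = val f 0%N + z *: H2_eval (H2_backshift f) z.
Proof.
apply: H2_eval_eq; rewrite -(cvg_shiftS (series _)).
rewrite (_ : (fun n => _) = fun n => val f 0%N + z *: series (fun k => z ^+ k *: val (H2_backshift f) k) n).
  by apply: cvgD; [exact: cvg_cst|apply: cvgZr; exact: H2_eval_cvg].
apply/funext => n; rewrite /series /= big_nat_recl //= expr0 scale1r scaler_sumr.
by congr (_ + _); apply: eq_bigr => k _; rewrite exprS scalerA.
Qed.
End Evaluation.

(** On the punctured disc [f_0 = - z g(z)] with [g] the backward shift of [f]; let [z] tend to 0. *)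
Lemma H2_eval0_head f : (forall z, 0 < `|z| < 1 -> H2_eval f z = 0) -> val f 0%N = 0.
Proof.
move=> f0; apply: hnorm_eq0; apply/eqP; rewrite eq_le hnorm_ge0 andbT.
pose M := hnorm (H2_backshift f).
have M0 : 0 <= M := hnorm_ge0 _.
apply/ler_addgt0Pl => e e0; rewrite addr0.
(* The bound [r <= 1/2] gives [(1 - r)^-1 <= 2], hence [|g(r)| <= 2 M]; the second bound gives
   [2 M r <= e], the [+ 1] keeping the denominator positive. *)
pose r := Num.min 2^-1 (e / (2 * M + 1)).
have M1 : 0 < 2 * M + 1 by rewrite ltr_wpDl // mulr_ge0.
have r0 : 0 < r by rewrite lt_min invr_gt0 ltr0n divr_gt0.
have r2 : r <= 2^-1 by rewrite ge_min lexx.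
have re : r <= e / (2 * M + 1) by rewrite ge_min lexx orbT.
have rn : `|r%:C| = r%:C :> R[i] by rewrite ger0_norm // ler0c ltW.
have r1 : `|r%:C| < 1 :> R[i] by rewrite rn -[1]/(1%:C) ltcR; lra.
have := f0 r%:C; rewrite r1 rn ltcR r0 => /(_ isT); rewrite (H2_eval_recl r1).
move/eqP; rewrite addr_eq0 => /eqP ->.
rewrite hnorm_oppr hnormZr ?(ltW r0) //; have := H2_eval_le r1 (H2_backshift f).
rewrite rn -/M /= => hl.
have i2 : (1 - r)^-1 <= 2 by rewrite invf_ple ?posrE //; lra.
have h2 : hnorm (H2_eval (H2_backshift f) r%:C) <= M * 2 by apply: le_trans hl _; rewrite ler_wpM2l.
rewrite ler_pdivlMr // in re; apply: le_trans re.
by rewrite ler_wpM2l ?(ltW r0) //; lra.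
Qed.

Lemma H2_eval_inj f g : (forall z, `|z| < 1 -> H2_eval f z = H2_eval g z) -> f = g.
Proof.
move=> fg; apply/eqP; rewrite -subr_eq0; apply/eqP/H2_val_inj => k.
(* The induction strips off one coefficient and divides by [z], so the claim carried along concerns
   the punctured disc. *)
have : forall z, 0 < `|z| < 1 -> H2_eval (f - g) z = 0.
  move=> z /andP[_ z1]; have := H2_evalD z1 (f - g) g; rewrite subrK fg //.
  by rewrite -[LHS]add0r => /addIr.
move: (f - g); elim: k => [|k IH] h h0; first by rewrite (H2_eval0_head h0).
apply: (IH (H2_backshift h)) => z /andP[z0 z1]; apply/eqP.
have := h0 z; rewrite z0 z1 => /(_ isT); rewrite (H2_eval_recl z1) (H2_eval0_head h0) add0r.
by move/eqP; rewrite scaler_eq0 -normr_eq0 gt_eqF.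
Qed.

(** Evaluation on the disc is injective, so the element chosen by [mult_op] is the one produced by
    [V]. *)
Lemma mult_opE (Theta : R[i] -> E -> E) (V : H2 E -> H2 E) :
  (forall f z, `|z| < 1 -> H2_eval (V f) z = Theta z (H2_eval f z)) -> mult_op Theta = V.
Proof.
move=> hV; apply/funext => f; rewrite /mult_op; apply: xget_unique => [z z1|g hg].
  exact: hV.
by apply: H2_eval_inj => z z1; rewrite hg // hV.
Qed.

End H2Operators.

(** * Multiplication by a linear symbol *)

Section LinearSymbol.
Variables (R : realType) (E : hilbertType R).
Variables (A B A' B' : E -> E).
Hypotheses (hA : contractive A) (hB : contractive B) (AA' : adjoint A A') (BB' : adjoint B B').
Hypotheses (isoAB : forall x, A' (A x) + B' (B x) = x).
Hypotheses (A'B : forall x, A' (B x) = 0) (B'A : forall x, B' (A x) = 0).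
Implicit Types f g : H2 E.

Let hA' := adjoint_contractive hA AA'.
Let hB' := adjoint_contractive hB BB'.

(* Multiplication by the symbol [A + z B]. *)
Definition symbol_op f : H2 E := H2_map A f + H2_shift (H2_map B f).
Definition symbol_adj f : H2 E := H2_map A' f + H2_map B' (H2_backshift f).

Lemma symbol_op0 f : val (symbol_op f) 0%N = A (val f 0%N).
Proof. by rewrite H2_valD H2_mapE //= addr0. Qed.

Lemma symbol_opS f k : val (symbol_op f) k.+1 = A (val f k.+1) + B (val f k).
Proof. by rewrite H2_valD H2_mapE //= H2_mapE. Qed.

Lemma symbol_adjE f k : val (symbol_adj f) k = A' (val f k) + B' (val f k.+1).
Proof. by rewrite H2_valD !H2_mapE. Qed.

Lemma symbol_adjoint : adjoint symbol_op symbol_adj.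
Proof.
move=> f g; rewrite innerDl innerDr (H2_map_adjoint hA hA' AA').
by rewrite H2_shift_adjoint (H2_map_adjoint hB hB' BB').
Qed.

(** The hypotheses [isoAB], [A'B] and [B'A] are the Fourier coefficients of
    [(A + z B)^* (A + z B) = 1] on the unit circle. *)
Lemma symbol_opK : cancel symbol_op symbol_adj.
Proof.
move=> f; apply: H2_val_inj => k; rewrite symbol_adjE symbol_opS (linD hB'.1) B'A add0r.
case: k => [|k]; first by rewrite symbol_op0 isoAB.
by rewrite symbol_opS (linD hA'.1) A'B addr0 isoAB.
Qed.

Lemma symbol_isometric : isometric symbol_op.
Proof.
split; first exact: adjoint_linear (adjoint_sym symbol_adjoint).
by move=> f; apply/eqP; rewrite -(@eqrXn2 _ 2) // -!innerxx symbol_adjoint symbol_opK.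
Qed.

Lemma symbol_adj_contractive : contractive symbol_adj.
Proof. exact: adjoint_contractive (isometric_contractive symbol_isometric) symbol_adjoint. Qed.

Lemma mult_op_symbol (Theta : R[i] -> E -> E) :
  (forall z x, Theta z x = A x + z *: B x) -> mult_op Theta = symbol_op.
Proof.
move=> hT; apply: mult_opE => f z z1.
by rewrite H2_evalD // H2_eval_shift // !H2_eval_map // hT.
Qed.

(** * Strong stability of the adjoint, from constants to all functions *)

Section Pure.

(** One small iterate is enough: by contractivity all later ones are no larger. *)
Let vanishing f := forall e : R, 0 < e -> exists m, hnorm (iter m symbol_adj f) < e.

Lemma iter_symbol_adj_le f m n : (m <= n)%N ->
  hnorm (iter n symbol_adj f) <= hnorm (iter m symbol_adj f).
Proof.
move=> /subnK <-; elim: (n - m)%N => [|k IH] //=.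
exact: le_trans (contractive_hnorm symbol_adj_contractive _) IH.
Qed.

Lemma iter_symbol_adjD f g m :
  iter m symbol_adj (f + g) = iter m symbol_adj f + iter m symbol_adj g.
Proof. by elim: m => //= m ->; rewrite (linD symbol_adj_contractive.1). Qed.

Lemma iter_symbol_adj_hnorm f m : hnorm (iter m symbol_adj f) <= hnorm f.
Proof. exact: (iter_symbol_adj_le f (leq0n m)). Qed.

Lemma vanishingD f g : vanishing f -> vanishing g -> vanishing (f + g).
Proof.
move=> hf hg e e0; have e20 : 0 < e / 2 by rewrite divr_gt0.
have [m hm] := hf _ e20; have [n hn] := hg _ e20; exists (maxn m n).
rewrite iter_symbol_adjD; apply: le_lt_trans (hnormD _ _) _; rewrite [ltRHS]splitr ltrD //.
  by apply: le_lt_trans hm; rewrite iter_symbol_adj_le ?leq_maxl.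
by apply: le_lt_trans hn; rewrite iter_symbol_adj_le ?leq_maxr.
Qed.

Lemma vanishing_adj f : vanishing f -> vanishing (symbol_adj f).
Proof.
move=> hf e /hf[m hm]; exists m; rewrite -iterSr; apply: le_lt_trans hm.
exact: contractive_hnorm symbol_adj_contractive _.
Qed.

(** Stability may be tested after finitely many steps and up to a small error. The case [m = 0] is
    density; larger [m] serves the induction on the degree. *)
Lemma vanishing_approx f : (forall e : R, 0 < e -> exists m g, vanishing g /\
  hnorm (iter m symbol_adj f - g) < e) -> vanishing f.
Proof.
move=> hf e e0; have e20 : 0 < e / 2 by rewrite divr_gt0.
have [m [g [hg fg]]] := hf _ e20; have [n hn] := hg _ e20; exists (n + m)%N.
rewrite iterD -[iter m _ f](subrK g) iter_symbol_adjD.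
apply: le_lt_trans (hnormD _ _) _; rewrite [ltRHS]splitr ltrD //.
exact: le_lt_trans (iter_symbol_adj_hnorm _ _) fg.
Qed.

Lemma monomial_subproof (k : nat) (x : E) n :
  \sum_(0 <= j < n) hnorm (if j == k then x else 0) ^+ 2 <= hnorm x ^+ 2.
Proof.
apply: (@le_trans _ _ (if (k < n)%N then hnorm x ^+ 2 else 0)); last by case: ifP; rewrite ?sqr_ge0.
elim: n => [|n IH]; first by rewrite big_geq.
rewrite big_nat_recr //= ltnS leq_eqVlt eq_sym; case: eqP IH => [->|_ IH] /=.
  by rewrite ltnn; rewrite -lerBrDr subrr.
by rewrite hnorm0 expr0n addr0.
Qed.

Definition monomial (k : nat) (x : E) : H2 E := H2_of (mem_H2 (monomial_subproof k x)).

Lemma monomial_le k x : hnorm (monomial k x) <= hnorm x.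
Proof. by rewrite hnorm_le_sqr; apply: H2_hnorm_le => n; exact: monomial_subproof. Qed.

Lemma symbol_adj_monomial0 x : symbol_adj (monomial 0 x) = monomial 0 (A' x).
Proof.
apply: H2_val_inj => k; rewrite symbol_adjE /= (lin0 hB'.1) addr0.
by case: k => //= k; rewrite (lin0 hA'.1).
Qed.

Lemma symbol_adj_monomialS k x :
  symbol_adj (monomial k.+1 x) = monomial k.+1 (A' x) + monomial k (B' x).
Proof.
apply: H2_val_inj => j; rewrite symbol_adjE H2_valD /= eqSS.
by congr (_ + _); case: eqP => // _; rewrite ?(lin0 hA'.1) ?(lin0 hB'.1).
Qed.

Hypothesis A'_vanish : forall x (e : R), 0 < e -> exists m, hnorm (iter m A' x) < e.

Lemma vanishing_monomial k x : vanishing (monomial k x).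
Proof.
elim: k x => [|k IH] x; apply: vanishing_approx => e e0; have [m hm] := A'_vanish x e0; exists m.
  exists 0; split; first by move=> d d0; exists 0%N; rewrite hnorm0.
  rewrite subr0 (_ : iter m _ _ = monomial 0 (iter m A' x)).
    exact: le_lt_trans (monomial_le _ _) hm.
  by elim: m {hm} => //= m ->; rewrite symbol_adj_monomial0.
(* The top coefficient evolves under [A'] alone; all that falls to lower degree is collected in [g]
   and vanishes by induction. *)
have [g [hg ->]] : exists g, vanishing g /\ iter m symbol_adj (monomial k.+1 x) = monomial k.+1 (iter m A' x) + g.
  elim: m {hm} => [|m [g [hg h]]].
    by exists 0; rewrite addr0; split=> // d d0; exists 0%N; rewrite hnorm0.
  exists (monomial k (B' (iter m A' x)) + symbol_adj g).
  split; first by apply: vanishingD; [exact: IH|exact: vanishing_adj].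
  rewrite /= h (linD symbol_adj_contractive.1) symbol_adj_monomialS; exact: esym (addrA _ _ _).
exists g; split=> //; rewrite addrK; exact: le_lt_trans (monomial_le _ _) hm.
Qed.

Lemma vanishing_all f : vanishing f.
Proof.
have [t ht] : exists t : nat -> H2 E, forall n, vanishing (t n) /\
    forall k, val (t n) k = if (k < n)%N then val f k else 0.
  (* The truncations of [f], built by adding one monomial at a time. *)
  exists (fun n => iteri n (fun k s => s + monomial k (val f k)) 0); elim=> [|n [IH1 IH2]].
    by split=> // d d0; exists 0%N; rewrite hnorm0.
  rewrite iteriS; split; first by apply: vanishingD => //; exact: vanishing_monomial.
  move=> k; rewrite H2_valD IH2 /= ltnS; case: ltngtP => [kn|nk|->]; rewrite ?addr0 ?add0r //.
apply: vanishing_approx => e e0; exists 0%N => /=.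
have e2 : 0 < e ^+ 2 by rewrite exprn_gt0.
have /cvgrPdist_lt/(_ _ e2)[N _ hN] := @H2_summable _ _ f.
exists (t N); split; first by case: (ht N).
rewrite -hnorm_lt //; apply: le_lt_trans (hN N (leqnn N)).
apply: H2_hnorm_le => n; rewrite -/(H2_sqr f) ger0_norm ?subr_ge0 ?H2_partial_le //.
(* The range up to [maxn n N] contains both the tested piece of the tail and the whole head, so
   their sum is a part of the norm of [f]. *)
rewrite lerBrDr; apply: le_trans (H2_partial_le f (maxn n N)).
have -> : \sum_(0 <= k < n) hnorm (val (f - t N) k) ^+ 2 =
    \sum_(0 <= k < n) (if (k < N)%N then 0 else hnorm (val f k) ^+ 2).
  apply: eq_bigr => k _; rewrite H2_valB (ht N).2; case: ifP => _; last by rewrite subr0.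
  by rewrite subrr hnorm0 expr0n.
apply: (@le_trans _ _ (\sum_(0 <= k < maxn n N) (if (k < N)%N then 0 else hnorm (val f k) ^+ 2) +
    \sum_(0 <= k < maxn n N) (if (k < N)%N then hnorm (val f k) ^+ 2 else 0))).
  apply: lerD.
    rewrite [leRHS](big_cat_nat (n := n)) ?leq_maxl //= lerDl.
    by apply: sumr_ge0 => k _; case: ifP => _ //; exact: sqr_ge0.
  rewrite [leRHS](big_cat_nat (n := N)) ?leq_maxr //= /series /=.
  rewrite [X in _ <= X + _](_ : _ = \sum_(0 <= k < N) hnorm (val f k) ^+ 2).
    rewrite lerDl; apply: sumr_ge0 => k _; case: ifP => _ //; exact: sqr_ge0.
  by apply: eq_big_nat => k /andP[_ ->].
rewrite -big_split /=; apply: ler_sum => k _.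
by case: ifP => _; rewrite ?add0r ?addr0.
Qed.

Lemma symbol_pure : pure symbol_op.
Proof.
move=> f; rewrite (adjoint_adj symbol_adjoint); apply/cvg0P_hnorm => e e0.
have [m hm] := vanishing_all f e0; exists m => n mn.
by apply: le_lt_trans hm; exact: iter_symbol_adj_le.
Qed.
End Pure.
End LinearSymbol.

(** The hypotheses are the coefficients of [(A1 + z B1) (A2 + z B2) = z]. *)
Lemma symbol_op_comp (R : realType) (E : hilbertType R) (A1 B1 A2 B2 : E -> E) :
  contractive A1 -> contractive B1 -> contractive A2 -> contractive B2 ->
  (forall x, A1 (A2 x) = 0) -> (forall x, B1 (B2 x) = 0) ->
  (forall x, A1 (B2 x) + B1 (A2 x) = x) ->
  forall f, symbol_op A1 B1 (symbol_op A2 B2 f) = H2_shift f.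
Proof.
move=> hA1 hB1 hA2 hB2 AA BB AB f; apply: H2_val_inj => -[|[|k]].
- by rewrite !symbol_op0 // AA.
- by rewrite !symbol_opS // !symbol_op0 // (linD hA1.1) AA add0r AB.
- by rewrite !symbol_opS // (linD hA1.1) (linD hB1.1) AA BB add0r addr0 AB.
Qed.

(** * Decay of coordinates *)

Lemma fin_sum_lt (R : realType) (n : nat) (c : nat -> nat -> R) :
  (forall i e, (i < n)%N -> 0 < e -> exists N, forall m, (N <= m)%N -> c i m < e) ->
  forall e, 0 < e -> exists N, forall m, (N <= m)%N -> \sum_(i < n) c i m < e.
Proof.
elim: n => [|n IH] h e e0; first by exists 0%N => m _; rewrite big_ord0.
have e20 : 0 < e / 2 by rewrite divr_gt0.
have [|N1 hN1] := IH _ (e / 2) e20; first by move=> i d i_n; apply: h; rewrite ltnW.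
have [N2 hN2] := h n (e / 2) (ltnSn n) e20.
exists (maxn N1 N2) => m; rewrite geq_max => /andP[m1 m2].
by rewrite big_ord_recr /= [ltRHS]splitr ltrD ?hN1 ?hN2.
Qed.

Section Decay.
Variables (R : realType) (H F G : hilbertType R).
Variables (S : H -> H) (d : H -> F) (d' : H -> G) (a : nat -> F) (b : nat -> G) (t : seq F).
Hypotheses (d_lin : linear d) (d_contr : forall g, hnorm (d g) <= hnorm g).
Hypothesis S_pure : forall g (e : R), 0 < e -> exists n, hnorm (iter n S g) < e.
Hypothesis d'_le : forall g, hnorm (d' g) ^+ 2 <= hnorm g ^+ 2 - hnorm (S g) ^+ 2.
Hypothesis d_dense : forall y, (forall g, inner (d g) y = 0) -> y = 0.
Hypothesis t_total : total_seq t.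
Hypothesis a_rec : forall m g, inner (a m) (d g) = inner (a m.+1) (d (S g)) + inner (b m.+1) (d' g).
Hypothesis a_norm : forall m, hnorm (a m) ^+ 2 = hnorm (a m.+1) ^+ 2 + hnorm (b m.+1) ^+ 2.

Let alpha m := hnorm (a m) ^+ 2.

Let alphaS m : alpha m.+1 <= alpha m.
Proof. by rewrite /alpha (a_norm m) lerDl sqr_ge0. Qed.

Let alpha_mono m n : (m <= n)%N -> alpha n <= alpha m.
Proof.
move=> /subnKC <-; elim: (n - m)%N => [|k IH]; first by rewrite addn0.
by rewrite addnS (le_trans (alphaS _)).
Qed.

(** Apply [a_rec] [n] times. Each term [<b, d' g>] is at most [|b|^2 + |d' g|^2]; by [a_norm] and
    [d'_le] both sums telescope. *)
Lemma decay_step n m g : `|inner (a m) (d g)| <=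
  (hnorm (a (m + n)) * hnorm (iter n S g) + (alpha m - alpha (m + n)) +
    (hnorm g ^+ 2 - hnorm (iter n S g) ^+ 2))%:C.
Proof.
elim: n m g => [|n IH] m g.
  rewrite addn0 /= !subrr !addr0; apply: le_trans (inner_CauchySchwarz _ _) _.
  by rewrite lecR ler_wpM2l ?hnorm_ge0.
rewrite a_rec addnS -addSn iterSr; apply: le_trans (ler_normD _ _) _.
apply: le_trans (lerD (IH _ _) (norm_inner_le _ _)) _; rewrite -rmorphD lecR.
have := d'_le g; have := a_norm m; rewrite -!/(alpha _); lra.
Qed.

(** Let [n] grow in [decay_step]: the first term tends to 0 because [a] is bounded and [S] is
    strongly stable. *)
Lemma decay_bound m (L : R) g : (forall n, L <= alpha n) ->
  `|inner (a m) (d g)| <= (alpha m - L + hnorm g ^+ 2)%:C.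
Proof.
move=> hL; rewrite -norm_innerE lecR; apply/ler_addgt0Pr => e e0.
have a1 : 0 < hnorm (a m) + 1 by rewrite ltr_wpDl ?hnorm_ge0.
have [n hn] := S_pure g (divr_gt0 e0 a1).
have := decay_step n m g; rewrite -norm_innerE lecR => /le_trans; apply.
have h1 : hnorm (a (m + n)) * hnorm (iter n S g) <= e.
  apply: (@le_trans _ _ ((hnorm (a m) + 1) * hnorm (iter n S g))).
    rewrite ler_wpM2r ?hnorm_ge0 // (le_trans (_ : _ <= hnorm (a m))) ?lerDl //.
    by rewrite hnorm_le_sqr; apply: alpha_mono; rewrite leq_addr.
  by rewrite mulrC -ler_pdivlMr // ltW.
have := hL (m + n)%N; have := sqr_ge0 (hnorm (iter n S g)); lra.
Qed.

Lemma decay_weak g (e : R) : 0 < e ->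
  exists N, forall m, (N <= m)%N -> complex.Re `|inner (a m) (d g)| < e.
Proof.
move=> e0; have alpha_cvg : cvgn alpha.
  apply: nonincreasing_is_cvgn; first by move=> m n; exact: alpha_mono.
  by exists 0 => _ [n _ <-]; exact: sqr_ge0.
pose L := limn alpha.
have hL n : L <= alpha n by apply: nonincreasing_cvgn_ge => // p q; exact: alpha_mono.
have g1 : 0 < hnorm g ^+ 2 + 1 by rewrite ltr_wpDl ?sqr_ge0.
(* Testing on [c g] gives [|<a m, d g>| <= (alpha m - L) / c + c |g|^2]. This [c] makes the second
   term at most [e / 2]; a large [m] then makes the first one smaller than [e / 2]. *)
pose c := e / 2 / (hnorm g ^+ 2 + 1).
have c0 : 0 < c by rewrite !divr_gt0.
have ce0 : 0 < c * (e / 2) by rewrite mulr_gt0 ?divr_gt0.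
have /cvgrPdist_lt/(_ _ ce0)[N _ hN] := alpha_cvg; exists N => m /hN /=.
rewrite distrC -/L => /(le_lt_trans (ler_norm _)) am.
have := decay_bound m (c%:C *: g) hL.
rewrite (linZ d_lin) innerZr conj_real normrM ger0_norm ?ler0c ?(ltW c0) //.
rewrite -norm_innerE -rmorphM /= lecR hnormZr ?(ltW c0) // => h.
rewrite -(ltr_pM2l c0); apply: le_lt_trans h _.
have -> : c * e = c * (e / 2) + c * (e / 2) by field.
rewrite ltr_leD // exprMn expr2 -mulrA ler_wpM2l ?(ltW c0) //.
by rewrite /c mulrAC ler_pdivrMr // ler_wpM2l ?lerDl // ltW // divr_gt0.
Qed.

(** Density of the range of [d] makes the finite orthonormal family from [orthonormal_range] a basis
    of [F], so decay against each basis vector is decay in norm. *)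
Lemma decay (e : R) : 0 < e -> exists m, hnorm (a m) < e.
Proof.
move=> e0; have [gs [og hg]] := orthonormal_range d_lin t_total.
have tg : total_seq (map d gs).
  move=> y oy; apply: d_dense => h; rewrite -hg inner_suml big1 // => i _.
  by rewrite innerZl (innerC _ y) oy ?conjC0 ?mulr0.
have [|N hN] := @fin_sum_lt R (size gs) (fun i m => complex.Re `|inner (a m) (d gs`_i)|) _ e e0.
  by move=> i eps _; exact: decay_weak.
exists N; have := hN N (leqnn N); apply: le_lt_trans.
rewrite -{1}(fourier_total (a N) og tg); apply: le_trans (hnorm_sum_le _ _ _) _.
rewrite size_map; apply: ler_sum => i _.
by rewrite hnormZ orthonormal_norm1 ?size_map // mulr1 (nth_map 0).
Qed.
End Decay.

(** * The dilation *)

Section Coordinates.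
Variables (R : realType) (E1 E2 : hilbertType R).
Local Notation E := (hsum E1 E2).

Lemma hsum_eq (x y : E) : x.1 = y.1 -> x.2 = y.2 -> x = y.
Proof. by case: x y => x1 x2 [y1 y2] /= -> ->. Qed.

Definition proj2 (x : E) : E := (0, x.2).

Lemma perp_proj2 (x : E) : perp proj2 x = (x.1, 0).
Proof. by apply: hsum_eq; [exact: subr0|exact: subrr]. Qed.

Lemma hnorm_hsum (x : E) : hnorm x ^+ 2 = hnorm x.1 ^+ 2 + hnorm x.2 ^+ 2.
Proof. by apply: complexI; rewrite rmorphD /= !hnorm_sqr inner_hsum. Qed.

Lemma proj2_contractive : contractive proj2.
Proof.
split=> [a x y|x]; first by apply: hsum_eq => //=; rewrite scaler0 addr0.
by rewrite hnorm_norm hnorm_le_sqr !hnorm_hsum /= hnorm0 expr0n add0r lerDr sqr_ge0.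
Qed.

Lemma perp_contractive : contractive (perp proj2).
Proof.
split=> [a x y|x]; first by rewrite /perp (proj2_contractive.1) opprD scalerBr addrACA.
rewrite hnorm_norm hnorm_le_sqr !hnorm_hsum perp_proj2 /= hnorm0 expr0n addr0 lerDl sqr_ge0 //.
Qed.

Lemma proj2_sa : adjoint proj2 proj2.
Proof. by move=> x y; rewrite !inner_hsum /= inner0l inner0r. Qed.

Lemma perp_sa : adjoint (perp proj2) (perp proj2).
Proof. by move=> x y; rewrite innerBl innerBr proj2_sa. Qed.

Lemma proj2_perp x : proj2 (perp proj2 x) = 0.
Proof. by rewrite perp_proj2. Qed.

Lemma perp_proj2K x : perp proj2 (proj2 x) = 0.
Proof. by rewrite perp_proj2. Qed.

Lemma perp_id x : perp proj2 (perp proj2 x) = perp proj2 x.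
Proof. by rewrite {1}/perp proj2_perp subr0. Qed.

Lemma proj2D x : proj2 x + perp proj2 x = x.
Proof. by rewrite addrC subrK. Qed.
End Coordinates.

(** * The BCL pair of a unitary extension of the defect isometry *)

Section Dilation.
Variables (R : realType) (H E1 E2 : hilbertType R).
Local Notation E := (hsum E1 E2).
Variables (S1 S2 : H -> H) (d1 : H -> E1) (d2 : H -> E2).
Variables (W W' : E -> E) (t1 : seq E1) (t2 : seq E2).
Hypotheses (S1_contr : contractive S1) (S2_contr : contractive S2).
Hypothesis S12 : forall h, S1 (S2 h) = S2 (S1 h).
Hypothesis S1_pure : forall g (e : R), 0 < e -> exists n, hnorm (iter n S1 g) < e.
Hypothesis S2_pure : forall g (e : R), 0 < e -> exists n, hnorm (iter n S2 g) < e.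
Hypotheses (d1_lin : linear d1) (d2_lin : linear d2).
Hypothesis d1_norm : forall g, hnorm (d1 g) ^+ 2 = hnorm g ^+ 2 - hnorm (S1 g) ^+ 2.
Hypothesis d2_norm : forall g, hnorm (d2 g) ^+ 2 = hnorm g ^+ 2 - hnorm (S2 g) ^+ 2.
Hypothesis d1_dense : forall y, (forall g, inner (d1 g) y = 0) -> y = 0.
Hypothesis d2_dense : forall y, (forall g, inner (d2 g) y = 0) -> y = 0.
Hypotheses (t1_total : total_seq t1) (t2_total : total_seq t2).
Hypotheses (WW' : adjoint W W') (WK : cancel W W') (W'K : cancel W' W).
Hypothesis W_defect : forall g, W (d1 g, d2 (S1 g)) = (d1 (S2 g), d2 g).

Let P : E -> E := @proj2 R E1 E2.
Let Q : E -> E := perp P.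

Let W_iso : isometric W.
Proof.
split; first exact: adjoint_linear (adjoint_sym WW').
by move=> f; apply/eqP; rewrite -(@eqrXn2 _ 2) // -!innerxx WW' WK.
Qed.
Let W'_iso : isometric W'.
Proof.
split; first exact: adjoint_linear WW'.
by move=> f; apply/eqP; rewrite -(@eqrXn2 _ 2) // -!innerxx (adjoint_sym WW') W'K.
Qed.
Let hW := isometric_contractive W_iso.
Let hW' := isometric_contractive W'_iso.
Let hP : contractive P := @proj2_contractive R E1 E2.
Let hQ : contractive Q := @perp_contractive R E1 E2.
Let QE x : Q x = (x.1, 0). Proof. exact: perp_proj2. Qed.
Let PQ x : P (Q x) = 0. Proof. exact: proj2_perp. Qed.
Let QP x : Q (P x) = 0. Proof. exact: perp_proj2K. Qed.
Let PP x : P (P x) = P x. Proof. by []. Qed.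
Let QQ x : Q (Q x) = Q x. Proof. exact: perp_id. Qed.
Let PQD x : P x + Q x = x. Proof. exact: proj2D. Qed.

Let d1_le g : hnorm (d1 g) <= hnorm g.
Proof. by rewrite hnorm_le_sqr d1_norm gerBl sqr_ge0. Qed.
Let d2_le g : hnorm (d2 g) <= hnorm g.
Proof. by rewrite hnorm_le_sqr d2_norm gerBl sqr_ge0. Qed.

(** With [U = W'] and [U^* = W], the symbols are [(P + z Q) W] here and [W' (Q + z P)] for [Psi]. *)
Let Phi : H2 E -> H2 E := symbol_op (P \o W) (Q \o W).
Let Psi : H2 E -> H2 E := symbol_op (W' \o Q) (W' \o P).

Let PW := contractive_comp hP hW.
Let QW := contractive_comp hQ hW.
Let WP := contractive_comp hW' hP.
Let WQ := contractive_comp hW' hQ.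

Let PW_adj : adjoint (P \o W) (W' \o P) := adjoint_comp (@proj2_sa R E1 E2) WW'.
Let QW_adj : adjoint (Q \o W) (W' \o Q) := adjoint_comp (@perp_sa R E1 E2) WW'.
Let WQ_adj : adjoint (W' \o Q) (Q \o W) := adjoint_sym QW_adj.
Let WP_adj : adjoint (W' \o P) (P \o W) := adjoint_sym PW_adj.

Let W'0 : W' 0 = 0. Proof. exact: lin0 W'_iso.1. Qed.

Lemma Phi_iso_cond : (forall x, W' (P (P (W x))) + W' (Q (Q (W x))) = x) /\
  (forall x, W' (P (Q (W x))) = 0) /\ (forall x, W' (Q (P (W x))) = 0).
Proof.
split; last by split=> x; rewrite ?PQ ?QP W'0.
by move=> x; rewrite PP QQ -(linD W'_iso.1) PQD WK.
Qed.

Lemma Psi_iso_cond : (forall x, Q (W (W' (Q x))) + P (W (W' (P x))) = x) /\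
  (forall x, Q (W (W' (P x))) = 0) /\ (forall x, P (W (W' (Q x))) = 0).
Proof.
split; last by split=> x; rewrite W'K ?PQ ?QP.
by move=> x; rewrite !W'K QQ PP addrC PQD.
Qed.

(** Pairing [P (u m)] with [W_defect] gives the recursion required by [decay], with the second
    coordinates of [u m] as [a], their first coordinates as [b], and [S1] as the stable operator. *)
Lemma Phi_vanish x (e : R) : 0 < e -> exists m, hnorm (iter m (W' \o P) x) < e.
Proof.
move=> e0; pose u m := iter m (W' \o P) x.
have uS m : u m.+1 = W' (P (u m)) by [].
have [] // := @decay R H E2 E1 S1 d2 d1 (fun m => (u m).2) (fun m => (u m).1) t2 _ _ _ _ _ _ _ _ e e0.
- by move=> g; rewrite d1_norm.
- move=> m g; have := WW' (d1 g, d2 (S1 g)) (P (u m)).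
  rewrite -uS W_defect !inner_hsum /= inner0r add0r => h.
  by rewrite innerC h rmorphD /= -!innerC addrC.
- move=> m; rewrite addrC -hnorm_hsum uS (isometric_hnorm W'_iso).
  by rewrite hnorm_hsum /= hnorm0 expr0n add0r.
(* The index shifts by one: [W'] is isometric, so [|u m.+1| = |P (u m)| = |(u m).2|]. *)
move=> m hm; exists m.+1; apply: le_lt_trans hm.
rewrite -[iter _ _ _]/(u m.+1) uS (isometric_hnorm W'_iso) hnorm_le_sqr.
by rewrite hnorm_hsum /= hnorm0 expr0n add0r.
Qed.

Lemma Psi_vanish x (e : R) : 0 < e -> exists m, hnorm (iter m (Q \o W) x) < e.
Proof.
(* The roles of the two factors are exchanged. [W_defect] describes images under [W], so the
   recursion is read off on [v], whose first coordinates decay. *)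
move=> e0; pose u m := iter m (Q \o W) x; pose v m := W (u m).
have uS m : u m.+1 = ((v m).1, 0) by rewrite /v -QE.
have [] // := @decay R H E1 E2 S2 d1 d2 (fun m => (v m).1) (fun m => (v m).2) t1 _ _ _ _ _ _ _ _ e e0.
- by move=> g; rewrite d2_norm.
- move=> m g; have : inner (v m.+1) (W (d1 g, d2 (S1 g))) = inner (v m).1 (d1 g).
    by rewrite /v WW' WK -/(v m) uS inner_hsum /= inner0l addr0.
  by rewrite W_defect inner_hsum => <-.
- move=> m; rewrite -hnorm_hsum (isometric_hnorm W_iso) uS.
  by rewrite hnorm_hsum /= hnorm0 expr0n addr0.
move=> m hm; exists m.+1; apply: le_lt_trans hm.
rewrite -[iter _ _ _]/(u m.+1) uS hnorm_le_sqr.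
by rewrite hnorm_hsum /= hnorm0 expr0n addr0.
Qed.

(** Both products are the shift, by [symbol_op_comp]. *)
Lemma Phi_Psi_commute f : Phi (Psi f) = Psi (Phi f).
Proof.
rewrite /Phi /Psi !symbol_op_comp //= => x; rewrite ?W'K ?PQ ?QP ?W'0 //.
- by rewrite -(linD W'_iso.1) PP QQ addrC PQD WK.
- by rewrite PP QQ PQD.
Qed.

(** * The isometry into the Hardy space *)

Definition defect_coef (g : H) : E := (d1 g, d2 (S1 g)).
Let q g := S1 (S2 g).
Definition dilation_seq (h : H) (k : nat) : E := defect_coef (iter k q h).

(** Telescoping: [|d1 g|^2 + |d2 (S1 g)|^2 = |g|^2 - |q g|^2] for each iterate [g]. *)
Lemma dilation_seq_sum h n : \sum_(0 <= k < n) hnorm (dilation_seq h k) ^+ 2 =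
  hnorm h ^+ 2 - hnorm (iter n q h) ^+ 2.
Proof.
elim: n => [|n IH]; first by rewrite big_geq //= subrr.
rewrite big_nat_recr //= IH hnorm_hsum /= d1_norm d2_norm /q -S12.
by ring.
Qed.

Lemma dilation_seq_bound h n :
  \sum_(0 <= k < n) hnorm (dilation_seq h k) ^+ 2 <= hnorm h ^+ 2.
Proof. by rewrite dilation_seq_sum gerBl sqr_ge0. Qed.

Definition dilation_map (h : H) : H2 E := H2_of (mem_H2 (dilation_seq_bound h)).

Let q_iter n h : iter n q h = iter n S2 (iter n S1 h).
Proof.
have comm k x : S1 (iter k S2 x) = iter k S2 (S1 x) by elim: k => //= k <-.
by elim: n => //= n ->; rewrite /q S12 comm.
Qed.

(** By commutation the powers of [q] factor as powers of [S2] after powers of [S1]: the latter tend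
    to 0 strongly and the former are contractive. *)
Lemma q_small h (e : R) : 0 < e -> exists N, forall n, (N <= n)%N -> hnorm (iter n q h) < e.
Proof.
move=> e0; have it_le (T : H -> H) (n : nat) (x : H) : contractive T -> hnorm (iter n T x) <= hnorm x.
  by move=> hT; elim: n => //= n; apply: le_trans; exact: contractive_hnorm hT _.
have [N hN] := S1_pure h e0; exists N => n Nn; rewrite q_iter.
apply: (@le_lt_trans _ _ (hnorm (iter n S1 h))); first exact: it_le.
by rewrite -(subnK Nn) iterD; apply: le_lt_trans hN; exact: it_le.
Qed.

Let q_lin : linear q.
Proof. by move=> a x y; rewrite /q S2_contr.1 S1_contr.1. Qed.

Let iter_q_lin n : linear (iter n q).
Proof. by elim: n => [|n IH] a x y //; rewrite !iterS (linD IH) (linZ IH) (linD q_lin) (linZ q_lin). Qed.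

Lemma dilation_seq_linear k : linear (dilation_seq^~ k).
Proof.
move=> a x y; rewrite /dilation_seq (linD (iter_q_lin k)) (linZ (iter_q_lin k)).
apply: hsum_eq; rewrite /defect_coef /=; first exact: d1_lin.
by rewrite (linD S1_contr.1) (linZ S1_contr.1); exact: d2_lin.
Qed.

Lemma dilation_map_isometric : isometric dilation_map.
Proof.
split=> [a x y|h].
  by apply: H2_val_inj => k; exact: dilation_seq_linear.
apply/eqP; rewrite -hnormE -[X in _ == X]hnormE; apply/eqP; congr _%:C.
apply/eqP; rewrite -(@eqrXn2 _ 2) ?hnorm_ge0 //; apply/eqP; rewrite hnorm_H2.
apply: cvg_lim => //; apply/cvgrPdist_lt => e e0.
have [|N hN] := q_small h (_ : 0 < Num.sqrt e); first by rewrite sqrtr_gt0.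
exists N => // n /hN; rewrite /= /series /= dilation_seq_sum opprB addrCA subrr addr0.
rewrite ger0_norm ?sqr_ge0 // -{2}[e]sqr_sqrtr ?(ltW e0) // hnorm_lt // sqrtr_gt0 //.
Qed.

(** Apply the injective [W] to each coefficient: by [W_defect] at [S1 g] both sides become
    [(d1 (q g), d2 (S1 g))]. *)
Lemma dilation_map_Phi h :
  dilation_map (S1 h) = symbol_adj (W' \o P) (W' \o Q) (dilation_map h).
Proof.
have qS k : iter k q (S1 h) = S1 (iter k q h) by elim: k => //= k ->; rewrite /q !S12.
apply: H2_val_inj => k; rewrite (symbol_adjE PW QW PW_adj QW_adj) /= /dilation_seq qS.
set g := iter k q h; rewrite -(linD W'_iso.1) -[iter k.+1 q h]/(q g).
apply: (can_inj WK); rewrite W'K W_defect QE.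
by apply: hsum_eq; rewrite /= /= ?add0r ?addr0 /q ?S12.
Qed.

(** In each coefficient [W_defect] is used at [g] for the first coordinate and at [q g] for the
    second. *)
Lemma dilation_map_Psi h :
  dilation_map (S2 h) = symbol_adj (Q \o W) (P \o W) (dilation_map h).
Proof.
have qS k : iter k q (S2 h) = S2 (iter k q h) by elim: k => //= k ->; rewrite /q !S12.
apply: H2_val_inj => k; rewrite (symbol_adjE WQ WP WQ_adj WP_adj) /= /dilation_seq qS.
set g := iter k q h; rewrite -[iter k.+1 q h]/(q g) /defect_coef !W_defect QE.
by apply: hsum_eq; rewrite /= /= ?add0r ?addr0.
Qed.

Lemma mult_op_Phi : mult_op (BCL_Phi W' P) = Phi.
Proof. by apply: (mult_op_symbol PW QW) => z x; rewrite /BCL_Phi (adjoint_adj (adjoint_sym WW')). Qed.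

Lemma mult_op_Psi : mult_op (BCL_Psi W' P) = Psi.
Proof.
by apply: (mult_op_symbol WQ WP) => z x; rewrite /BCL_Psi (linD W'_iso.1) (linZ W'_iso.1).
Qed.

Lemma BCL_triple_extension : BCL_triple W' P.
Proof.
split; split.
- by split; [exact: W'_iso.1|exact: contractive_continuous].
- by move=> x; rewrite (adjoint_adj (adjoint_sym WW')) W'K.
- by move=> x; rewrite (adjoint_adj (adjoint_sym WW')) WK.
- by split; [exact: hP.1|exact: contractive_continuous].
- exact: PP.
- by rewrite (adjoint_adj (@proj2_sa R E1 E2)).
Qed.

Lemma commuting_pure_isometries_extension :
  commuting_pure_isometries (mult_op (BCL_Phi W' P)) (mult_op (BCL_Psi W' P)).
Proof.
have [iso1 [cross1 cross1']] := Phi_iso_cond; have [iso2 [cross2 cross2']] := Psi_iso_cond.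
rewrite mult_op_Phi mult_op_Psi; split; last exact: Phi_Psi_commute.
- split; first exact: symbol_isometric PW QW PW_adj QW_adj iso1 cross1 cross1'.
  by apply: symbol_pure PW QW PW_adj QW_adj iso1 cross1 cross1' _; exact: Phi_vanish.
- split; first exact: symbol_isometric WQ WP WQ_adj WP_adj iso2 cross2 cross2'.
  by apply: symbol_pure WQ WP WQ_adj WP_adj iso2 cross2 cross2' _; exact: Psi_vanish.
Qed.

Lemma dilation_extension : exists Pi : H -> H2 E, [/\ isometric Pi,
  forall h, Pi (S1 h) = adj (mult_op (BCL_Phi W' P)) (Pi h) &
  forall h, Pi (S2 h) = adj (mult_op (BCL_Psi W' P)) (Pi h)].
Proof.
exists dilation_map; rewrite mult_op_Phi mult_op_Psi; split.
- exact: dilation_map_isometric.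
- move=> h; rewrite dilation_map_Phi.
  by rewrite (adjoint_adj (symbol_adjoint PW QW PW_adj QW_adj)).
- move=> h; rewrite dilation_map_Psi.
  by rewrite (adjoint_adj (symbol_adjoint WQ WP WQ_adj WP_adj)).
Qed.

End Dilation.

(** * Application to the defect spaces of the given pair *)

Theorem theorem5p2 (R : realType) (H : hilbertType R) (T1 T2 : H -> H)
    (hT : commuting_pure_contractions T1 T2)
    (dim1 : finite_dimensional (defect_space T1))
    (dim2 : finite_dimensional (defect_space T2)) :
  exists U P : hsum (defect_space T1) (defect_space T2) ->
               hsum (defect_space T1) (defect_space T2),
    BCL_triple U P /\
    commuting_pure_isometries (mult_op (BCL_Phi U P)) (mult_op (BCL_Psi U P)) /\
    dilation T1 T2 (mult_op (BCL_Phi U P)) (mult_op (BCL_Psi U P)).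
Proof.
have [[T1c T1p] [T2c T2p] T12] := hT.
have adj1 := adj_adjoint T1c; have adj2 := adj_adjoint T2c.
have S1c := adjoint_contractive T1c adj1; have S2c := adjoint_contractive T2c adj2.
have S12 h : adj T1 (adj T2 h) = adj T2 (adj T1 h).
  by apply: inner_injr => z; rewrite -adj1 -adj2 -T12 adj1 adj2.
have pure_small (T : H -> H) : pure T -> forall g (e : R), 0 < e ->
    exists n, hnorm (iter n (adj T) g) < e.
  by move=> Tp g e e0; have [N hN] := (cvg0P_hnorm _).1 (Tp g) e e0; exists N; exact: hN.
have d_norm (T : H -> H) : contractive T -> forall g,
    hnorm (defect_map T g) ^+ 2 = hnorm g ^+ 2 - hnorm (adj T g) ^+ 2.
  move=> Tc g; apply: complexI.
  by rewrite hnorm_sqr defect_map_inner // rmorphB /= !hnorm_sqr.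
have [t1 ht1] := finite_dimensional_total dim1.
have [t2 ht2] := finite_dimensional_total dim2.
have [t ht] := total_seq_hsum ht1 ht2.
pose E : hilbertType R := hsum (defect_space T1) (defect_space T2).
have l1 := @defect_map_linear R H T1; have l2 := @defect_map_linear R H T2.
have [||g h|W [W' [WW' WK W'K Wd]]] := @unitary_extension R E H
  (fun g => (defect_map T1 g, defect_map T2 (adj T1 g)) : E)
  (fun g => (defect_map T1 (adj T2 g), defect_map T2 g) : E) t _ _ ht.
- move=> a x y; apply: hsum_eq => /=; first exact: l1.
  by rewrite (linD S1c.1) (linZ S1c.1); exact: l2.
- move=> a x y; apply: hsum_eq => /=; last exact: l2.
  by rewrite (linD S2c.1) (linZ S2c.1); exact: l1.
(* With [S_i = adj T_i], both Gram forms collapse to [<g, h> - <S_1 S_2 g, S_1 S_2 h>]. *)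
- rewrite !inner_hsum_pair !defect_map_inner // S12.
  by rewrite addrA subrK [RHS]addrC addrA subrK S12.
have P1 := pure_small _ T1p; have P2 := pure_small _ T2p.
have n1 := d_norm _ T1c; have n2 := d_norm _ T2c.
have D1 := defect_map_dense (T := T1); have D2 := defect_map_dense (T := T2).
(* The BCL symbol [Phi] contains the adjoint of [U], which has to be [W]; hence [U = W']. *)
exists W', (@proj2 R (defect_space T1) (defect_space T2)); split; last split.
- exact: BCL_triple_extension WW' WK W'K.
- exact: (commuting_pure_isometries_extension P1 P2 l1 l2 n1 n2 D1 D2 ht1 ht2 WW' WK W'K Wd).
- exact: (dilation_extension S1c S2c S12 P1 l1 l2 n1 n2 WW' WK W'K Wd).
Qed.
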